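(* For every $\alpha > 0$ there exists $\beta_0 > 0$ such that for every $0 < \beta \le \beta_0$ there exists $n_0 \in \mathbb{N}$ such that the following holds for every $n \ge n_0$. Let $H$ be a $3$-graph on $n$ vertices with $\delta_2(H) \ge (7/9 + \alpha)n$. Then there exists a squared-tight-path $P$ in $H$ on at most $7\sqrt{\beta}\, n$ vertices such that for all sets $L \subseteq V(H) \setminus V(P)$ with $|L| \le \beta^2 n$, there is a squared-tight-path $P'$ in $H$ with $V(P') = V(P) \cup L$ such that $P$ and $P'$ have the same initial triple and the same final triple.
   Context: A $3$-graph $H$ consists of a finite vertex set $V(H)$ and a set $E(H)$ of $3$-element subsets of $V(H)$ (edges). The minimum codegree $\delta_2(H)$ is the largest $m$ such that every pair of distinct vertices of $H$ is contained in at least $m$ edges. $K_4^3$ is the complete $3$-graph on four vertices. A squared-tight-path in $H$ is a sequence $(v_1,\dots,v_\ell)$ of distinct vertices in which every set of four consecutive vertices forms a copy of $K_4^3$ in $H$; its vertex set is $V(P)=\{v_1,\dots,v_\ell\}$, its initial triple is the ordered triple $(v_1,v_2,v_3)$ and its final triple is the ordered triple $(v_{\ell-2},v_{\ell-1},v_\ell)$. *)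

(* Defs.v *)
From mathcomp Require Import all_boot all_order all_algebra.
From mathcomp Require Import reals.

Set Implicit Arguments.
Unset Strict Implicit.
Unset Printing Implicit Defensive.

Record three_graph (V : finType) := ThreeGraph {
  edges : {set {set V}};
  edges_card3 : forall e, e \in edges -> #|e| = 3
}.

Section ThreeGraph.
Variables (V : finType) (H : three_graph V).

Definition codegree (x y : V) : nat :=
  #|[set e in edges H | (x \in e) && (y \in e)]|.

Definition codegree_ge (m : nat) : bool :=
  [forall x, forall y, (x != y) ==> (m <= codegree x y)].

(* The largest m such that every pair lies in at least m edges. Such an m is
   at most #|edges H| as soon as there is a pair of distinct vertices; see
   leq_min_codegree. With at most one vertex the value is a junk one. *)
Definition min_codegree : nat :=
  \max_(m < #|edges H|.+1 | codegree_ge m) m.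

Lemma leq_min_codegree (m : nat) :
  1 < #|V| -> (m <= min_codegree) = codegree_ge m.
Proof.
move=> V_gt1; rewrite /min_codegree; apply/idP/idP => [|Hm].
  have ge0 : codegree_ge (ord0 : 'I_(#|edges H|.+1)).
    by apply/forallP => x; apply/forallP => y; apply/implyP.
  have i0 : 0 < #|[pred i : 'I_(#|edges H|.+1) | codegree_ge i]|.
    by apply/card_gt0P; exists ord0.
  have [i Pi ->] := eq_bigmax_cond (@nat_of_ord #|edges H|.+1) i0.
  move=> lemi; apply/forallP => x; apply/forallP => y; apply/implyP => xy.
  move/forallP/(_ x)/forallP/(_ y)/implyP/(_ xy): Pi.
  exact: leq_trans.
have m_lt : m < #|edges H|.+1.
  have [x [y [_ _ xy]]] : exists x y : V, [/\ x \in V, y \in V & x != y].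
    by have /card_gt1P := V_gt1.
  move/forallP/(_ x)/forallP/(_ y)/implyP/(_ xy): Hm => Hm.
  rewrite ltnS (leq_trans Hm) //; apply: subset_leq_card.
  by apply/subsetP => e; rewrite inE => /andP[].
exact: (leq_bigmax_cond (Ordinal m_lt)).
Qed.

(* S spans a copy of K_4^3 in H. *)
Definition is_K43 (S : {set V}) : bool :=
  (#|S| == 4) && [forall T : {set V}, (T \subset S) && (#|T| == 3) ==> (T \in edges H)].

(* The length is at least 3 so that the initial and final triples exist. *)
Definition squared_tight_path (P : seq V) : Prop :=
  [/\ 3 <= size P, uniq P &
      forall i, i + 4 <= size P -> is_K43 [set x in take 4 (drop i P)]].

End ThreeGraph.

Definition path_vertices (V : finType) (P : seq V) : {set V} := [set x in P].

Definition initial_triple (V : finType) (P : seq V) : seq V := take 3 P.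

Definition final_triple (V : finType) (P : seq V) : seq V :=
  drop (size P - 3) P.

(* Main.v *)
Require Import Defs.
From mathcomp Require Import all_boot all_order all_algebra zify ring lra.
From mathcomp Require Import reals.
Set Implicit Arguments.
Unset Strict Implicit.
Unset Printing Implicit Defensive.

(** Any 2-colouring of the edges of a 3-graph with codegree above 7n/9 in which
    every K_4^3 is monochromatic is constant: suitable weights on the pairs of a
    few vertices produce a further vertex whose links contradict a bichromatic
    configuration. Colouring the edges reachable by squared-tight-walks from a
    given edge then shows that all edges, in all orders, are so connected. The
    orders come from swaps inside one K_4^3, and the same swaps, run once with
    and once without a vertex v lying in a clique with that K_4^3, give two
    walks with the same ends and, apart from v, the same multiset of vertices.
    Bounded random samples inherit the codegree condition, so these walks are
    found in many samples; blow-ups of samples turn the walks into paths that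
    avoid a small forbidden set, which yields connecting paths of bounded length
    and absorbers of 31 vertices, each serving a positive proportion of any
    given weight on the vertices. Absorbers are chosen greedily and chained,
    where a vertex served k times has weight 2^-k, until each vertex is served
    at least |L| times. The vertices of L then get distinct absorbers. *)

(** * Light vertices and weight certificates *)

(** The structural arguments rest on the fact that a pair is missed by fewer than 2/9 of the
    vertices. Up to four pairs therefore have a common neighbour, but the six pairs of a clique need
    not: there may be no larger clique in which to reorder vertices. A vertex missing at most one
    pair of the clique is the substitute, since it still lets a walk exchange the two ends of that
    pair. Passing to samples serves two purposes. A walk in the whole 3-graph could have length of
    order n^3 and repeat vertices, whereas in a sample of m vertices its length is bounded by m^3 +
    3. Moreover there are only finitely many words over m letters, so a single word occurs in a
    positive proportion of samples and can be blown up, with repetitions becoming different copies.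
    With h about beta^2 n, a constant multiple of h absorbers lowers the total weight to 4^-h n.
    This is less than 2^-h, so no vertex has been served fewer than h times. The path thus has
    O(beta^2 n) vertices, and beta0 absorbs the constant. *)

Record triple_system (V : finType) := TripleSystem {
  tri :> V -> V -> V -> bool;
  triC : forall x y z, tri x y z = tri y x z;
  triA : forall x y z, tri x y z = tri x z y;
  triI : forall x y, tri x x y = false }.

Definition nbr (V : finType) (e : triple_system V) x y := [set z | e x y z].

Definition codense (V : finType) (e : triple_system V) :=
  forall x y, x != y -> 7 * #|V| < 9 * #|nbr e x y|.

Definition K4 (V : finType) (e : triple_system V) a b c d :=
  [&& e a b c, e a b d, e a c d & e b c d].

Section Weights.
Variables (V : finType) (e : triple_system V).

(* A pair is missed by fewer than 2/9 of the vertices, so some vertex misses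
   pairs of less than 2/9 of the total weight. *)
Lemma light_vertex (ps : seq (V * V * nat)) b :
  codense e -> all (fun p => p.1.1 != p.1.2) ps ->
  0 < \sum_(p <- ps) p.2 -> 2 * \sum_(p <- ps) p.2 <= 9 * b ->
  exists z, \sum_(p <- ps) p.2 * ~~ e p.1.1 p.1.2 z < b.
Proof.
move=> dn neq w_gt0 wb; apply/existsP; apply: contraT.
rewrite negb_exists => /forallP big.
have h1 : #|V| * b <= \sum_(z : V) \sum_(p <- ps) p.2 * ~~ e p.1.1 p.1.2 z.
  rewrite -sum_nat_const; apply: leq_sum => z _; rewrite leqNgt; exact: big.
rewrite exchange_big /= in h1.
(* The strict inequality in [codense] leaves one spare unit per pair, hence the total weight as an
   extra summand on the left. This surplus gives the contradiction, because the bound on [b] allows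
   equality. *)
have h2 : 9 * \sum_(p <- ps) \sum_(z : V) p.2 * ~~ e p.1.1 p.1.2 z
          + \sum_(p <- ps) p.2 <= 2 * #|V| * \sum_(p <- ps) p.2.
  rewrite !big_distrr -big_split /= big_seq [leqRHS]big_seq.
  apply: leq_sum => p pin; rewrite -big_distrr /=.
  have -> : \sum_(z : V) (~~ e p.1.1 p.1.2 z : nat) = #|V| - #|nbr e p.1.1 p.1.2|.
    rewrite -(cardsC (nbr e p.1.1 p.1.2)) addKn -sum1_card [RHS]big_mkcond /=.
    by apply: eq_bigr => z _; rewrite !inE; case: (e _ _ _).
  have le : 9 * (#|V| - #|nbr e p.1.1 p.1.2|) + 1 <= 2 * #|V|.
    have := dn _ _ (allP neq p pin).
    have : #|nbr e p.1.1 p.1.2| <= #|V| by apply: max_card.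
    by move: #|V| #|nbr e p.1.1 p.1.2| => n d; lia.
  by rewrite mulnCA -[X in _ + X]muln1 -mulnDr mulnC leq_mul2r le orbT.
have h3 := leq_mul (leqnn #|V|) wb.
have h4 := leq_mul (leqnn 9) h1.
set S := \sum_(p <- ps) p.2 in w_gt0 wb h2 h3.
move: h1 h2 h3 h4; set T := \sum_(j <- ps) _.
have -> : 2 * #|V| * S = #|V| * (2 * S) by rewrite -mulnA mulnCA.
have -> : #|V| * (9 * b) = 9 * (#|V| * b) by rewrite mulnCA.
by move: (#|V| * (2 * S)) (#|V| * b) T w_gt0 => x y z; lia.
Qed.

End Weights.

(* Statuses of the pairs of a fixed vertex tuple towards one further vertex:
   0 for a missing edge, 1 and 2 for the two colours. A nogood is a list of
   (pair, status) requirements that cannot hold together. *)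
Definition holds (a : seq nat) (ng : seq (nat * nat)) :=
  all (fun pc => (pc.1 < size a) && (nth 0 a pc.1 == pc.2)) ng.

(* Conditionals rather than boolean connectives, so that evaluation by value
   prunes the search. *)
Fixpoint search (its : seq (nat * seq (seq (nat * nat)))) (a : seq nat) b :=
  if b == 0 then true else
  if its is (w, ngs) :: its' then
    all (fun c => if has (holds (rcons a c)) ngs then true
                  else search its' (rcons a c) (if c == 0 then b - w else b))
        [:: 1; 2; 0]
  else false.

Lemma holds_cat a a' ng : holds a ng -> holds (a ++ a') ng.
Proof.
move=> /allP h; apply/allP => pc /h /andP [lt eq].
by rewrite size_cat nth_cat lt ltn_addr.
Qed.

(** [b] is the missed weight still to be reached: status 0 pays the weight of its pair, and a branch
    closes when nothing is left to pay or a nogood is met. So statuses that meet no nogood miss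
    weight at least [b]. *)
Lemma searchP its a b a' :
  search its a b -> size a' = size its -> all (fun c => c < 3) a' ->
  (forall it ng, it \in its -> ng \in it.2 -> ~~ holds (a ++ a') ng) ->
  b <= \sum_(p <- zip (unzip1 its) a') p.1 * (p.2 == 0).
Proof.
elim: its a b a' => [|[w ngs] its IH] a b [|c a'] //=; first by case: eqP => // ->.
case: eqVneq => [->|_] //= sr [sz] /andP [c3 a3] ngP.
rewrite big_cons /= -leq_subLR; rewrite -cat_rcons in ngP *.
have nov : has (holds (rcons a c)) ngs = false.
  apply: negbTE; rewrite -all_predC; apply/allP => ng ngin /=.
  apply: contra (ngP _ ng (mem_head _ _) ngin); exact: holds_cat.
have {sr} : if has (holds (rcons a c)) ngs then true
            else search its (rcons a c) (if c == 0 then b - w else b).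
  by case/and4P: sr => s1 s2 s0 _; case: c c3 {ngP nov} => [|[|[|]]].
rewrite nov => /IH /(_ sz a3) le.
have {}le := le (fun it ng itin => ngP it ng (mem_behead (s := _ :: _) itin)).
by move: le; case: (c == 0); rewrite ?muln1 ?muln0 ?subn0.
Qed.

(** Colexicographic rank of a pair i < j. In the weights and nogoods below, the positions 0, ..., 9
    stand for the pairs 01, 02, 12, 03, 13, 23, 04, 14, 24, 34. *)
Definition pair_code i j := j * j.-1 %/ 2 + i.
Definition pairs k := flatten [seq [seq (i, j) | i <- iota 0 j] | j <- iota 0 k].

(** If a further vertex forms edges with all three pairs of an edge of status [c], the four vertices
    are a clique and all its statuses are [c]. The other seven nonzero combinations are excluded. *)
Definition tri_nogoods (q : nat * nat * nat * nat) :=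
  let: (i, j, l, c) := q in
  [seq [:: (pair_code i j, p.1.1); (pair_code i l, p.1.2); (pair_code j l, p.2)]
  | p <- [seq (xy, z) | xy <- [seq (x, y) | x <- [:: 1; 2], y <- [:: 1; 2]],
                           z <- [:: 1; 2]]
  & p != (c, c, c)].

(** Each nogood is tested only at the last pair that it mentions, where its truth gets decided. *)
Definition items k ws (ngs : seq (seq (nat * nat))) :=
  [seq (nth 0 ws p, [seq ng <- ngs | foldr maxn 0 (unzip1 ng) == p])
  | p <- iota 0 (size (pairs k))].

(* [tl] lists the known statuses of triples among [k] vertices, [ws] the weights
   of their pairs: [light_vertex] gives a further vertex that misses pairs of
   weight less than [b], and [search] refutes every choice of statuses for it.
   The weights used below are solutions of linear programs. *)
Definition certificate k tl ngs ws b :=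
  [&& all (fun q : nat * nat * nat * nat => let: (i, j, l, c) := q in
           [&& 0 < c, pair_code i j < size (pairs k),
               pair_code i l < size (pairs k), pair_code j l < size (pairs k),
               nth (0, 0) (pairs k) (pair_code i j) == (i, j),
               nth (0, 0) (pairs k) (pair_code i l) == (i, l) &
               nth (0, 0) (pairs k) (pair_code j l) == (j, l)]) tl,
      all (fun p : nat * nat => [&& p.1 < k, p.2 < k & p.1 != p.2]) (pairs k),
      size ws == size (pairs k), 0 < sumn ws, 2 * sumn ws <= 9 * b &
      search (items k ws (flatten (map tri_nogoods tl) ++ ngs)) [::] b].

Section Colouring.
Variables (V : finType) (e : triple_system V) (col : V -> V -> V -> bool).
Hypothesis dn : codense e.
Hypothesis colC : forall x y z, col x y z = col y x z.
Hypothesis colA : forall x y z, col x y z = col x z y.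
Hypothesis col_K4 : forall a b c d, K4 e a b c d -> col a b c = col a b d.

(** [t] is the colour that counts as 2 (blue); the other one counts as 1 (red). Negating [t]
    exchanges the roles of the colours. *)
Definition status t x y z : nat :=
  if e x y z then if col x y z == t then 2 else 1 else 0.

Lemma statusC t x y z : status t x y z = status t y x z.
Proof. by rewrite /status triC colC. Qed.

Lemma statusA t x y z : status t x y z = status t x z y.
Proof. by rewrite /status triA colA. Qed.

Lemma status_K4 t x y z w :
  0 < status t x y z -> 0 < status t x y w -> 0 < status t x z w ->
  0 < status t y z w ->
  [/\ status t x y w = status t x y z, status t x z w = status t x y z &
      status t y z w = status t x y z].
Proof.
rewrite /status; case e1: (e x y z) => //; case e2: (e x y w) => //.
case e3: (e x z w) => //; case e4: (e y z w) => // _ _ _ _.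
have k1 : K4 e x y z w by rewrite /K4 e1 e2 e3 e4.
have k2 : K4 e x z y w by rewrite /K4 triA e1 e3 e2 triC e4.
have k3 : K4 e y z x w by rewrite /K4 triA triC e1 e4 (triC e y x) e2 triC e3.
have := col_K4 k1; have := col_K4 k2; have := col_K4 k3.
by rewrite (colA y z x) (colC y x z) (colA x z y) => <- <- <-.
Qed.

(** The statuses of the light vertex [z] meet no nogood, so by [searchP] they miss weight at least
    [b], while [z] misses less. The list [ngs] holds requirements that are refuted separately for
    every [z]; through it, configurations excluded earlier help to exclude later ones. *)
Lemma certificate_contra k tl ngs ws b t x0 (x : seq V) :
  certificate k tl ngs ws b -> uniq x -> size x = k ->
  all (fun q : nat * nat * nat * nat => let: (i, j, l, c) := q in
        status t (nth x0 x i) (nth x0 x j) (nth x0 x l) == c) tl ->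
  (forall z ng, ng \in ngs ->
     ~~ all (fun pc : nat * nat =>
          status t (nth x0 x (nth (0, 0) (pairs k) pc.1).1)
                   (nth x0 x (nth (0, 0) (pairs k) pc.1).2) z == pc.2) ng) ->
  False.
Proof.
case/and5P=> /allP tlP prP /eqP szw w_gt0 /andP [wb sr] ux szx /allP tlS ngP.
pose P := pairs k.
pose ps := [seq (nth x0 x p.1.1, nth x0 x p.1.2, p.2) | p <- zip P ws].
have sumE : \sum_(p <- ps) p.2 = sumn ws.
  by rewrite big_map -(big_map snd xpredT id) /= -[map snd _]/(unzip2 _)
             unzip2_zip ?szw // sumnE.
have [] := @light_vertex V e ps b dn; rewrite ?sumE //.
  apply/allP => _ /mapP [[p w] pin ->] /=.
  have /(allP prP) /and3P [l1 l2 ne] : p \in P.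
    by rewrite -(@unzip1_zip _ _ P ws) ?szw //; apply/mapP; exists (p, w).
  by rewrite nth_uniq ?szx.
move=> z; rewrite ltnNge => /negP; apply.
pose a := [seq status t (nth x0 x p.1) (nth x0 x p.2) z | p <- P].
have nthA i : i < size P ->
  nth 0 a i = status t (nth x0 x (nth (0, 0) P i).1) (nth x0 x (nth (0, 0) P i).2) z.
  by move=> lt; rewrite (nth_map (0, 0)).
have /searchP := sr => /(_ a); rewrite size_map size_map size_iota => /(_ erefl).
have -> : all (fun c => c < 3) a.
  by apply/allP => _ /mapP [p _ ->]; rewrite /status; case: (tri _ _ _ _) => //; case: eqP.
move=> /(_ isT) le; apply: leq_trans (le _) _.
- move=> it ng /mapP [p _ ->] /=; rewrite mem_filter mem_cat => /andP [_].
  case/orP => [/flatten_mapP [[[[i j] l] c] qin]|ngin].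
    have /and5P [c0 s1 s2 s3 /and3P [/eqP n1 /eqP n2 /eqP n3]] := tlP _ qin.
    have /eqP cE := tlS _ qin.
    case/mapP=> [[[c1 c2] c3]]; rewrite mem_filter => /andP [ne cin] ->.
    have [d1 d2 d3] : [/\ 0 < c1, 0 < c2 & 0 < c3].
      case/allpairsPdep: cin => xy [z' [xyin zin [exy ->]]].
      move: xyin; rewrite -exy; case/allpairsPdep => [x2 [y2 [xin yin [-> ->]]]].
      by move: xin yin zin; rewrite !inE => /pred2P [] -> /pred2P [] -> /pred2P [] ->.
    apply: contra ne; rewrite /holds /= size_map s1 s2 s3 /= !nthA // n1 n2 n3 andbT /=.
    case/and3P=> /eqP h1 /eqP h2 /eqP h3.
    have := @status_K4 t (nth x0 x i) (nth x0 x j) (nth x0 x l) z.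
    by rewrite cE h1 h2 h3 => /(_ c0 d1 d2 d3) [-> -> ->].
  apply: contra (ngP z _ ngin) => /allP h; apply/allP => pc /h.
  by rewrite size_map => /andP [lt]; rewrite nthA.
have -> : unzip1 (items k ws (flatten (map tri_nogoods tl) ++ ngs)) = ws.
  rewrite /unzip1 /items -map_comp /=.
  by apply: (@eq_from_nth _ 0) => [|i]; rewrite size_map size_iota ?szw // => lt;
     rewrite (nth_map 0) ?size_iota // nth_iota.
rewrite big_map; apply: eq_leq.
rewrite -[LHS](big_map (fun p : nat * nat => (p.2, p.1)) xpredT
  (fun p => p.2 * (p.1 == 0))).
have -> : [seq (p.2, p.1) | p <- zip ws a] = zip a ws.
  by elim: ws a {szw w_gt0 wb sr ps sumE le nthA tlP} => [|w ws IH] [|c a] //=; rewrite IH.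
have -> : zip a ws = [seq (status t (nth x0 x p.1.1) (nth x0 x p.1.2) z, p.2)
                     | p <- zip P ws].
  rewrite /a; elim: (P) (ws) => [|p P' IH] [|w ws'] //=; by rewrite IH.
rewrite !big_map; apply: eq_bigr => -[p w] _ /=.
by rewrite /status; case: (tri _ _ _ _) => //; case: (_ == t).
Qed.

End Colouring.

(** * Colourings that are constant on cliques *)

Section CliqueColouring.
Variables (V : finType) (e : triple_system V) (col : V -> V -> V -> bool).
Hypothesis dn : codense e.
Hypothesis colC : forall x y z, col x y z = col y x z.
Hypothesis colA : forall x y z, col x y z = col x z y.
Hypothesis col_K4 : forall a b c d, K4 e a b c d -> col a b c = col a b d.

Local Notation st := (status e col).

Lemma st_rot t x y z : st t x y z = st t y z x.
Proof. by rewrite statusC // statusA. Qed.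

Lemma tri_neq x y z : e x y z -> [/\ x != y, x != z & y != z].
Proof.
move=> E; split; apply/eqP => E'; move: E.
- by rewrite E' triI.
- by rewrite triA E' triI.
- by rewrite triC triA E' triI.
Qed.

Lemma st_neq t x y z c : st t x y z = c.+1 -> [/\ x != y, x != z & y != z].
Proof. by rewrite /status; case E: (e x y z) => // _; exact: tri_neq E. Qed.

Lemma st_swap t x y z : st t x y z = st t y x z.
Proof. by rewrite statusC. Qed.

Ltac st_sym :=
  match goal with h : st _ _ _ _ = _ |- _ =>
    solve [ exact: h | rewrite st_swap; exact: h
          | rewrite st_rot; solve [ exact: h | rewrite st_swap; exact: h
              | rewrite st_rot; solve [exact: h | rewrite st_swap; exact: h ]]]
  end.

Definition blue t a b c d :=
  [&& st t a b c == 2, st t a b d == 2, st t a c d == 2 & st t b c d == 2].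

(** The names list the colours that [v] gives to pairs of a blue clique, with [b] for status 2 and
    [r] for status 1: here on a star centred at [a], in [link_rbr] on the path c, b, a, d, in
    [link_rbbr] on the 4-cycle a, c, b, d. *)
Lemma link_brr t a b c d v : blue t a b c d ->
  st t v a b = 2 -> st t v a c = 1 -> st t v a d = 1 -> False.
Proof.
case/and4P=> /eqP h1 /eqP h2 /eqP h3 /eqP h4 h5 h6 h7.
apply: (@certificate_contra V e col dn colC colA col_K4 5
  [:: (0,1,2,2); (0,1,3,2); (0,2,3,2); (1,2,3,2); (0,1,4,2); (0,2,4,1); (0,3,4,1)]
  [::] [:: 1;1;0;1;0;1;2;1;1;1] 2 t a [:: a; b; c; d; v]).
- by vm_compute.
- have [n1 n2 n3] := st_neq h1; have [_ n5 n6] := st_neq h4.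
  have [_ n4 _] := st_neq h2.
  have [n7 n8 n9] := st_neq h5; have [_ n10 _] := st_neq h6.
  have [_ n11 _] := st_neq h7.
  by rewrite /= !inE !negb_or n1 n2 n3 n4 n5 n6 !(eq_sym _ v) n7 n8 n10 n11.
- by [].
- by rewrite /= h1 h2 h3 h4 -!(st_rot _ v) h5 h6 h7.
- by [].
Qed.

Lemma link_rbr t a b c d v : blue t a b c d ->
  st t v a b = 2 -> st t v b c = 1 -> st t v a d = 1 -> False.
Proof.
case/and4P=> /eqP h1 /eqP h2 /eqP h3 /eqP h4 h5 h6 h7.
apply: (@certificate_contra V e col dn colC colA col_K4 5
  [:: (0,1,2,2); (0,1,3,2); (0,2,3,2); (1,2,3,2); (0,1,4,2); (1,2,4,1); (0,3,4,1)]
  [::] [:: 3;1;2;2;1;1;2;2;2;2] 4 t a [:: a; b; c; d; v]).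
- by vm_compute.
- have [n1 n2 n3] := st_neq h1; have [_ n5 n6] := st_neq h4.
  have [_ n4 _] := st_neq h2.
  have [n7 n8 n9] := st_neq h5; have [_ n10 _] := st_neq h6.
  have [_ n11 _] := st_neq h7.
  by rewrite /= !inE !negb_or n1 n2 n3 n4 n5 n6 !(eq_sym _ v) n7 n8 n10 n11.
- by [].
- by rewrite /= h1 h2 h3 h4 -!(st_rot _ v) h5 h6 h7.
- by [].
Qed.

Lemma link_rbbr t a b c d v : blue t a b c d ->
  st t v a c = 1 -> st t v b c = 2 -> st t v a d = 1 -> st t v b d = 2 -> False.
Proof.
case/and4P=> /eqP h1 /eqP h2 /eqP h3 /eqP h4 h5 h6 h7 h8.
apply: (@certificate_contra V e col dn colC colA col_K4 5
  [:: (0,1,2,2); (0,1,3,2); (0,2,3,2); (1,2,3,2);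
      (0,2,4,1); (1,2,4,2); (0,3,4,1); (1,3,4,2)]
  [:: [:: (1,1); (6,1); (8,1); (9,2)]]
  [:: 0;1;0;1;1;1;2;1;1;1] 2 t a [:: a; b; c; d; v]).
- by vm_compute.
- have [n1 n2 n3] := st_neq h1; have [_ n5 n6] := st_neq h4.
  have [_ n4 _] := st_neq h2; have [n7 n8 _] := st_neq h5.
  have [n9 n10 _] := st_neq h8.
  by rewrite /= !inE !negb_or n1 n2 n3 n4 n5 n6 !(eq_sym _ v) n7 n8 n9 n10.
- by [].
- by rewrite /= h1 h2 h3 h4 -!(st_rot _ v) h5 h6 h7 h8.
(* The nogood makes [a v z c] a red clique. With the colours exchanged, [d] shows on it the pattern
   excluded by [link_rbr]. *)
move=> z ng; rewrite inE => /eqP -> /=; apply/negP.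
case/and5P=> /eqP g1 /eqP g2 /eqP g3 /eqP g4 _.
have ft c1 c2 c3 k : st t c1 c2 c3 = k -> 0 < k < 3 -> st (~~ t) c1 c2 c3 = 3 - k.
  rewrite /status; case: (tri _ _ _ _) => [<-|<-//] _.
  by case: (col _ _ _); case: (t).
have {}g1 := ft _ _ _ _ g1 isT; have {}g2 := ft _ _ _ _ g2 isT.
have {}g3 := ft _ _ _ _ g3 isT; have {}g4 := ft _ _ _ _ g4 isT.
have {}h5 := ft _ _ _ _ h5 isT; have {}h7 := ft _ _ _ _ h7 isT.
have {}h3 := ft _ _ _ _ h3 isT.
by apply: (@link_rbr (~~ t) a v z c d); first (apply/and4P; split; apply/eqP); st_sym.
Qed.

(** All triples of a, b, c, d, z are blue, while the red pairs ab, ac, ad, zb, zc in the link of [v]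
    form the complete bipartite graph between {a, z} and {b, c, d} without zd. This is the case of
    [link_rrr] that the shorter patterns leave open. *)
Lemma link_K33_step t a b c d v z : blue t a b c d ->
  st t v a b = 1 -> st t v a c = 1 -> st t v a d = 1 ->
  blue t a b c z -> st t a d z = 2 -> st t b d z = 2 -> st t c d z = 2 ->
  st t b v z = 1 -> st t c v z = 1 -> False.
Proof.
case/and4P=> /eqP h1 /eqP h2 /eqP h3 /eqP h4 h5 h6 h7.
case/and4P=> _ /eqP h8 /eqP h9 /eqP h10 h11 h12 h13 h14 h15.
apply: (@certificate_contra V e col dn colC colA col_K4 6
  [:: (0,1,2,2); (0,1,3,2); (0,2,3,2); (1,2,3,2); (0,1,4,1); (0,2,4,1); (0,3,4,1);
      (0,1,5,2); (0,2,5,2); (1,2,5,2); (0,3,5,2); (1,3,5,2); (2,3,5,2);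
      (1,4,5,1); (2,4,5,1)]
  [::] [:: 1;1;1;1;1;1;2;2;2;0;1;1;1;1;2] 4 t a [:: a; b; c; d; v; z]).
- by vm_compute.
- have [n1 n2 n3] := st_neq h1; have [_ n5 n6] := st_neq h4.
  have [_ n4 _] := st_neq h2; have [n7 n8 _] := st_neq h5.
  have [_ n9 _] := st_neq h6; have [_ n10 _] := st_neq h7.
  have [_ n11 n12] := st_neq h8; have [_ n13 n14] := st_neq h13.
  have [_ _ n15] := st_neq h14.
  by rewrite /= !inE !negb_or n1 n2 n3 n4 n5 n6 n11 n12 n13 n14 n15
    !(eq_sym _ v) n7 n8 n9 n10.
- by [].
- by rewrite /= h1 h2 h3 h4 -!(st_rot _ v) h5 h6 h7 h8 h9 h10 h11 h12 h13 h14 h15.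
- by [].
Qed.

Lemma link_rrr t a b c d v : blue t a b c d ->
  st t v a b = 1 -> st t v a c = 1 -> st t v a d = 1 -> False.
Proof.
move=> bl h5 h6 h7; have := bl.
case/and4P=> /eqP h1 /eqP h2 /eqP h3 /eqP h4.
apply: (@certificate_contra V e col dn colC colA col_K4 5
  [:: (0,1,2,2); (0,1,3,2); (0,2,3,2); (1,2,3,2); (0,1,4,1); (0,2,4,1); (0,3,4,1)]
  [:: [:: (0,2); (1,2); (2,2); (7,1); (8,2)];
      [:: (0,2); (1,2); (2,2); (7,2); (8,1)];
      [:: (0,2); (1,2); (2,2); (7,2); (8,2)];
      [:: (0,2); (1,2); (2,2); (3,2); (4,2); (5,2); (7,1); (8,1)]]
  [:: 1;1;1;1;1;1;1;1;1;0] 2 t a [:: a; b; c; d; v]).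
- by vm_compute.
- have [n1 n2 n3] := st_neq h1; have [_ n5 n6] := st_neq h4.
  have [_ n4 _] := st_neq h2; have [n7 n8 _] := st_neq h5.
  have [_ n9 _] := st_neq h6; have [_ n10 _] := st_neq h7.
  by rewrite /= !inE !negb_or n1 n2 n3 n4 n5 n6 !(eq_sym _ v) n7 n8 n9 n10.
- by [].
- by rewrite /= h1 h2 h3 h4 -!(st_rot _ v) h5 h6 h7.
(* In all four nogoods [z] completes a, b, c to a blue clique, and [v] colours bz, cz red-blue,
   blue-red, blue-blue or red-red. The first three are earlier patterns on that clique; the last one
   also has [z] blue with the pairs through [d]. *)
move=> z ng; rewrite !inE => /or4P [] /eqP -> /=; apply/negP.
- case/and5P=> /eqP g1 /eqP g2 /eqP g3 /eqP g4 /andP [/eqP g5 _].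
  by apply: (@link_rbr t c z b a v); first (apply/and4P; split; apply/eqP); st_sym.
- case/and5P=> /eqP g1 /eqP g2 /eqP g3 /eqP g4 /andP [/eqP g5 _].
  by apply: (@link_rbr t b z c a v); first (apply/and4P; split; apply/eqP); st_sym.
- case/and5P=> /eqP g1 /eqP g2 /eqP g3 /eqP g4 /andP [/eqP g5 _].
  by apply: (@link_rbbr t a z b c v); first (apply/and4P; split; apply/eqP); st_sym.
- case/and5P=> /eqP g1 /eqP g2 /eqP g3 /eqP g4 /and5P [/eqP g5 /eqP g6 /eqP g7 /eqP g8 _].
  by apply: (@link_K33_step t a b c d v z) => //; first (apply/and4P; split; apply/eqP); st_sym.
Qed.

(** Four pairs always have a common neighbour, as 4 * 2/9 < 1. If [a x y] had the other colour, a
    common neighbour [z] of ab, ax, ay, xy would make [a x y z] a clique on which [b] shows a star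
    at [a] with two edges of the opposite colour and a third of either colour; both stars are
    excluded. *)
Lemma mono_triangle a b x y : e a b x -> e a b y -> e a x y ->
  col a b x = col a b y -> col a x y = col a b x.
Proof.
move=> e1 e2 e3 c12; apply/eqP; rewrite eq_sym; apply: contraT => c3.
have [] := @light_vertex V e [:: (a, b, 1); (a, x, 1); (a, y, 1); (x, y, 1)] 1 dn.
- by have [n1 _ _] := tri_neq e1; have [n2 n3 n4] := tri_neq e3; rewrite /= n1 n2 n3 n4.
- by rewrite unlock.
- by rewrite unlock.
move=> z; rewrite unlock /= !mul1n addn0 ltnS leqn0 !addn_eq0 !eqb0 !negbK.
case/and4P=> f1 f2 f3 f4.
pose t := col a x y.
have [||||k1 k2 k3] := @status_K4 V e col colC colA col_K4 t a x y z.
1-4: by rewrite /status ?e3 ?f2 ?f3 ?f4; case: eqP.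
have k0 : st t a x y = 2 by rewrite /status e3 eqxx.
rewrite k0 in k1 k2 k3.
have bl : blue t a x y z by rewrite /blue k0 k1 k2 k3.
have nt : col a b x == t = false by apply: negbTE.
have h1 : st t b a x = 1 by rewrite /status triC e1 colC nt.
have h2 : st t b a y = 1 by rewrite /status triC e2 colC -c12 nt.
have : st t b a z = 1 \/ st t b a z = 2.
  by rewrite /status triC f1; case: eqP; [right|left].
case=> h3; first by case: (link_rrr bl h1 h2 h3).
case: (@link_brr t a z x y b) => //; apply/and4P; split; apply/eqP; st_sym.
Qed.

(** A common neighbour [z] of ab, ay, by, ax makes [a b y z] a clique, so abz has the colour of aby.
    In the link of [a], two edges of the triangle b, x, z share a colour, and by [mono_triangle] the
    third has it as well. *)
Lemma mono_pair a b x y : e a b x -> e a b y -> col a b x = col a b y.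
Proof.
move=> e1 e2; apply/eqP; apply: contraT => c12.
have [] := @light_vertex V e [:: (a, b, 1); (a, y, 1); (b, y, 1); (a, x, 1)] 1 dn.
- by have [n1 n2 n3] := tri_neq e1; have [_ n4 n5] := tri_neq e2; rewrite /= n1 n2 n4 n5.
- by rewrite unlock.
- by rewrite unlock.
move=> z; rewrite unlock /= !mul1n addn0 ltnS leqn0 !addn_eq0 !eqb0 !negbK.
case/and4P=> f1 f2 f3 f4.
have K : K4 e a b y z by rewrite /K4 e2 f1 f2 f3.
have cz := col_K4 K.
have [cx|cx] := eqVneq (col a x z) (col a x b).
  have := @mono_triangle a x b z; rewrite -cx triA e1 f4 f1 => /(_ isT isT isT erefl).
  by move=> E; rewrite cz E cx colA eqxx in c12.
have cx' : col a x z = col a b z.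
  by move: c12 cx; rewrite cz (colA a x b); do 3!case: (col _ _ _).
have := @mono_triangle a z b x; rewrite (triA e a z b) (triA e a z x) f1 f4 e1.
rewrite (colA a z b) (colA a z x) cx' => /(_ isT isT isT erefl) E.
by rewrite E cz eqxx in c12.
Qed.

Lemma mono_vertex a b c x y : e a b c -> e a x y -> col a b c = col a x y.
Proof.
move=> e1 e2.
have [] := @light_vertex V e [:: (a, b, 1); (a, x, 1)] 1 dn.
- by have [n1 _ _] := tri_neq e1; have [n2 _ _] := tri_neq e2; rewrite /= n1 n2.
- by rewrite unlock.
- by rewrite unlock.
move=> z; rewrite unlock /= !mul1n addn0 ltnS leqn0 !addn_eq0 !eqb0 !negbK.
case/andP=> f1 f2.
rewrite (mono_pair e1 f1) (mono_pair e2 f2) !(colA a _ z).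
by apply: mono_pair; rewrite triA.
Qed.

Lemma mono_edges a b c x y z : e a b c -> e x y z -> col a b c = col x y z.
Proof.
move=> e1 e2; have [ax|nax] := eqVneq a x.
  by rewrite -ax in e2 *; apply: mono_vertex.
have [] := @light_vertex V e [:: (a, x, 1)] 1 dn.
- by rewrite /= nax.
- by rewrite unlock.
- by rewrite unlock.
move=> w; rewrite unlock /= !mul1n addn0 ltnS leqn0 eqb0 negbK => f.
by rewrite (mono_vertex e1 f) colC; apply: mono_vertex; rewrite // triC.
Qed.

End CliqueColouring.

(** * Swaps and tight connectivity *)

Lemma tri_rot (V : finType) (e : triple_system V) x y z : e x y z = e y z x.
Proof. by rewrite triC triA. Qed.

Ltac edge_sym :=
  match goal with h : is_true (tri _ _ _ _) |- _ =>
    solve [ exact: h | rewrite triC; exact: h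
          | rewrite tri_rot; solve [ exact: h | rewrite triC; exact: h
              | rewrite tri_rot; solve [exact: h | rewrite triC; exact: h ]]]
  end.

Ltac K4_sym := solve [apply/and4P; split; edge_sym].

Section Orders.
Variables (V : finType) (e : triple_system V).
Hypothesis dn : codense e.

Lemma K4_rot a b c d : K4 e a b c d = K4 e b c d a.
Proof.
by rewrite /K4 (tri_rot e b c a) (tri_rot e c a b) -(tri_rot e a b d) -(tri_rot e a c d)
  andbCA andbA [X in X && _]andbC -!andbA; do 3!bool_congr.
Qed.

Lemma K4_swap a b c d : K4 e a b c d = K4 e b a c d.
Proof. by rewrite /K4 (triC e b a c) (triC e b a d) (andbC (e b c d)). Qed.

Lemma K4_flip a b c d : K4 e a b c d = K4 e a b d c.
Proof. by rewrite 2![LHS]K4_rot 2![RHS]K4_rot; exact: K4_swap. Qed.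

(* [z] can stand in for [x] as well as for [y] in the clique [p q x y]. *)
Definition swapper p q x y z :=
  [&& e p q z, e p x z, e p y z, e q x z & e q y z].
Definition swappable p q x y := [exists z, swapper p q x y z].

Lemma swappableC p q x y : swappable p q x y = swappable q p x y.
Proof.
apply: eq_existsb => z; rewrite /swapper (triC e q p).
by do 5!case: (tri _ _ _ _).
Qed.

Lemma swappable_flip p q x y : swappable p q x y = swappable p q y x.
Proof.
apply: eq_existsb => z; rewrite /swapper.
by do 5!case: (tri _ _ _ _).
Qed.

(** Let a pair weigh 2 if it is swappable and 1 otherwise. With at most three swappable pairs the
    total is at most 9, so some vertex misses weight at most 1, that is, at most one pair, and that
    pair is not swappable. But a vertex that misses at most one given pair of the clique is a
    swapper for this pair. *)
Lemma many_swappable a b c d : K4 e a b c d ->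
  3 < swappable c d a b + swappable b d a c + swappable b c a d +
      swappable a d b c + swappable a c b d + swappable a b c d.
Proof.
case/and4P=> e1 e2 e3 e4; rewrite ltnNge; apply/negP => le.
pose w p q x y := (swappable p q x y).+1.
have [] := @light_vertex V e [:: (a, b, w c d a b); (a, c, w b d a c);
  (a, d, w b c a d); (b, c, w a d b c); (b, d, w a c b d); (c, d, w a b c d)] 2 dn.
- have [n1 n2 n3] := tri_neq e1; have [_ n5 n6] := tri_neq e4.
  by have [_ n4 _] := tri_neq e2; rewrite /= n1 n2 n3 n4 n5 n6.
- by rewrite unlock.
- rewrite unlock /= /w; move: le; do 6!move: (nat_of_bool _) => ?; lia.
move=> z; rewrite unlock /= addn0 /w.
have sw p q x y : swapper p q x y z -> swappable p q x y by move=> h; apply/existsP; exists z.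
move: (sw c d a b) (sw b d a c) (sw b c a d) (sw a d b c) (sw a c b d) (sw a b c d) le.
rewrite /swapper (triC e b a) (triC e c a) (triC e d a) (triC e c b) (triC e d b) (triC e d c).
move: (swappable c d a b) (swappable b d a c) (swappable b c a d) (swappable a d b c)
  (swappable a c b d) (swappable a b c d) (e a b z) (e a c z) (e a d z) (e b c z)
  (e b d z) (e c d z) => s1 s2 s3 s4 s5 s6 f1 f2 f3 f4 f5 f6.
move=> h1 h2 h3 h4 h5 h6 le lt.
have : ~~ f1 + (~~ f2 + (~~ f3 + (~~ f4 + (~~ f5 + ~~ f6)))) < 2.
  by apply: leq_ltn_trans lt; rewrite !leq_add // leq_pmull.
case: f1 h1 h2 h3 h4 h5 h6 lt; case: f2; case: f3; case: f4; case: f5; case: f6 => //=;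
  case: s1 le; case: s2; case: s3; case: s4; case: s5; case: s6 => //= _ h1 h2 h3 h4 h5 h6;
  by [move: (h1 isT)|move: (h2 isT)|move: (h3 isT)|move: (h4 isT)|move: (h5 isT)|move: (h6 isT)|].
Qed.

Ltac perm4 := apply/permP => ? /=; clear; do 4!move: (nat_of_bool _) => ?; lia.

Ltac swap_sym :=
  match goal with
  | h : is_true (swappable ?p ?q ?x ?y) |- is_true (swappable ?p ?q ?x ?y) => exact: h
  | h : is_true (swappable ?q ?p ?x ?y) |- is_true (swappable ?p ?q ?x ?y) =>
      rewrite swappableC; exact: h
  | h : is_true (swappable ?p ?q ?y ?x) |- is_true (swappable ?p ?q ?x ?y) =>
      rewrite swappable_flip; exact: h
  | h : is_true (swappable ?q ?p ?y ?x) |- is_true (swappable ?p ?q ?x ?y) =>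
      rewrite swappableC swappable_flip; exact: h
  end.

(** A graph on four vertices with at least four edges has a Hamiltonian path; [p1] to [p12] are the
    possible paths up to reversal. *)
Lemma swappable_path a b c d : K4 e a b c d ->
  exists g0 g1 g2 g3, [/\ perm_eq [:: g0; g1; g2; g3] [:: a; b; c; d],
    K4 e g0 g1 g2 g3, swappable g2 g3 g0 g1, swappable g0 g3 g1 g2 &
    swappable g0 g1 g2 g3].
Proof.
move=> K; have := many_swappable K; case/and4P: K => e1 e2 e3 e4.
set goal := (exists g0, _).
have mk x y z w : perm_eq [:: x; y; z; w] [:: a; b; c; d] -> K4 e x y z w ->
    swappable z w x y -> swappable x w y z -> swappable x y z w -> goal.
  by move=> *; exists x, y, z, w.
have p1 := @mk a b c d ltac:(perm4) ltac:(K4_sym).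
have p2 := @mk a b d c ltac:(perm4) ltac:(K4_sym).
have p3 := @mk a c b d ltac:(perm4) ltac:(K4_sym).
have p4 := @mk a c d b ltac:(perm4) ltac:(K4_sym).
have p5 := @mk a d b c ltac:(perm4) ltac:(K4_sym).
have p6 := @mk a d c b ltac:(perm4) ltac:(K4_sym).
have p7 := @mk b a c d ltac:(perm4) ltac:(K4_sym).
have p8 := @mk b a d c ltac:(perm4) ltac:(K4_sym).
have p9 := @mk b c a d ltac:(perm4) ltac:(K4_sym).
have p10 := @mk b d a c ltac:(perm4) ltac:(K4_sym).
have p11 := @mk c a b d ltac:(perm4) ltac:(K4_sym).
have p12 := @mk c b a d ltac:(perm4) ltac:(K4_sym).
clear mk; clearbody goal.
case: (boolP (swappable c d a b)) => s1; case: (boolP (swappable b d a c)) => s2;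
case: (boolP (swappable b c a d)) => s3; case: (boolP (swappable a d b c)) => s4;
case: (boolP (swappable a c b d)) => s5; case: (boolP (swappable a b c d)) => s6 // _;
first
  [ by apply: p1; swap_sym | by apply: p2; swap_sym | by apply: p3; swap_sym
  | by apply: p4; swap_sym | by apply: p5; swap_sym | by apply: p6; swap_sym
  | by apply: p7; swap_sym | by apply: p8; swap_sym | by apply: p9; swap_sym
  | by apply: p10; swap_sym | by apply: p11; swap_sym | by apply: p12; swap_sym ].
Qed.

Section Invariant.
Variable f : V * V * V -> bool.
Hypothesis f_step : forall a b c d, K4 e a b c d -> f (a, b, c) = f (b, c, d).

Lemma swap_invariant p q x y : K4 e p q x y -> swappable p q x y ->
  f (p, q, x) = f (p, q, y) /\ f (p, x, q) = f (p, y, q).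
Proof.
case/and4P=> e1 e2 e3 e4 /existsP [z /and5P [g1 g2 g3 g4 g5]]; split.
  transitivity (f (q, x, y)); first by apply: f_step; K4_sym.
  transitivity (f (x, y, p)); first by apply: f_step; K4_sym.
  transitivity (f (y, p, q)); first by apply: f_step; K4_sym.
  transitivity (f (p, q, z)); first by apply: f_step; K4_sym.
  transitivity (f (q, z, x)); first by apply: f_step; K4_sym.
  transitivity (f (z, x, p)); first by apply: f_step; K4_sym.
  by transitivity (f (x, p, q)); apply: f_step; K4_sym.
transitivity (f (x, q, y)); first by apply: f_step; K4_sym.
transitivity (f (q, y, p)); first by apply: f_step; K4_sym.
transitivity (f (y, p, z)); first by apply: f_step; K4_sym.
transitivity (f (p, z, q)); first by apply: f_step; K4_sym.
transitivity (f (z, q, x)); first by apply: f_step; K4_sym.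
transitivity (f (q, x, p)); first by apply: f_step; K4_sym.
by transitivity (f (x, p, y)); apply: f_step; K4_sym.
Qed.

(** [f_step] gives the cyclic rotations; together with the transpositions of [g0], [g1] and of [g1],
    [g2] they generate all orders of the four vertices. *)
Lemma order_invariant a b c d : K4 e a b c d ->
  [/\ f (b, a, c) = f (a, b, c), f (a, c, b) = f (a, b, c) & f (a, b, d) = f (a, b, c)].
Proof.
move=> K; have [g0 [g1 [g2 [g3 [pm Kg s1 s2 _]]]]] := swappable_path K.
have all_eq x y z : x \in [:: g0; g1; g2; g3] -> y \in [:: g0; g1; g2; g3] ->
    z \in [:: g0; g1; g2; g3] -> uniq [:: x; y; z] -> f (x, y, z) = f (g0, g1, g2).
  have /and4P [e1 e2 e3 e4] := Kg.
  have rot x1 x2 x3 x4 : K4 e x1 x2 x3 x4 -> [/\ f (x2, x3, x4) = f (x1, x2, x3),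
      f (x3, x4, x1) = f (x1, x2, x3) & f (x4, x1, x2) = f (x1, x2, x3)].
    case/and4P=> h1 h2 h3 h4.
    have r1 : f (x1, x2, x3) = f (x2, x3, x4) by apply: f_step; K4_sym.
    have r2 : f (x2, x3, x4) = f (x3, x4, x1) by apply: f_step; K4_sym.
    have r3 : f (x3, x4, x1) = f (x4, x1, x2) by apply: f_step; K4_sym.
    by rewrite r1 r2 r3.
  have [k1 k2 k3] := @rot g0 g1 g2 g3 ltac:(K4_sym).
  have [k4 k5 k6] := @rot g0 g1 g3 g2 ltac:(K4_sym).
  have [k7 k8 k9] := @rot g0 g2 g1 g3 ltac:(K4_sym).
  have [l1 l2 l3] := @rot g0 g2 g3 g1 ltac:(K4_sym).
  have [l4 l5 l6] := @rot g0 g3 g1 g2 ltac:(K4_sym).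
  have [l7 l8 l9] := @rot g0 g3 g2 g1 ltac:(K4_sym).
  have [m1 m2] := @swap_invariant g2 g3 g0 g1 ltac:(K4_sym) s1.
  have [m3 m4] := @swap_invariant g3 g2 g0 g1 ltac:(K4_sym) ltac:(swap_sym).
  have [m5 m6] := @swap_invariant g0 g3 g1 g2 ltac:(K4_sym) s2.
  have [m7 m8] := @swap_invariant g3 g0 g1 g2 ltac:(K4_sym) ltac:(swap_sym).
  rewrite !inE => /or4P [] /eqP -> /or4P [] /eqP -> /or4P [] /eqP -> /=;
    rewrite ?inE ?eqxx ?orbT ?andbF //= => _; congruence.
have mg x : x \in [:: a; b; c; d] -> x \in [:: g0; g1; g2; g3] by rewrite (perm_mem pm).
case/and4P: K => e1 e2 e3 e4.
have [n1 n2 n3] := tri_neq e1; have [_ n5 n6] := tri_neq e2.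
have [ia ib ic id] : [/\ a \in [:: g0; g1; g2; g3], b \in [:: g0; g1; g2; g3],
  c \in [:: g0; g1; g2; g3] & d \in [:: g0; g1; g2; g3]].
  by split; apply: mg; rewrite !inE eqxx ?orbT.
by split; rewrite !all_eq //= !inE ?negb_or ?n1 ?n2 ?n3 ?n5 ?n6 // eq_sym ?n1 ?n3 ?n2.
Qed.

End Invariant.

Lemma edge_K4 a b c : e a b c -> exists d, K4 e a b c d.
Proof.
move=> e1; have [] := @light_vertex V e [:: (a, b, 1); (a, c, 1); (b, c, 1)] 1 dn.
- by have [n1 n2 n3] := tri_neq e1; rewrite /= n1 n2 n3.
- by rewrite unlock.
- by rewrite unlock.
move=> z; rewrite unlock /= !mul1n addn0 ltnS leqn0 !addn_eq0 !eqb0 !negbK.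
by case/and3P=> f1 f2 f3; exists z; apply/and4P.
Qed.

Definition tight_step : rel (V * V * V) :=
  fun p q => [&& q.1.1 == p.1.2, q.1.2 == p.2 & K4 e p.1.1 p.1.2 p.2 q.2].

Lemma tight_connected a b c x y z :
  e a b c -> e x y z -> connect tight_step (a, b, c) (x, y, z).
Proof.
move=> e1 e2; pose f p := connect tight_step (a, b, c) p.
have fstep1 p q r s : K4 e p q r s -> tight_step (p, q, r) (q, r, s).
  by rewrite /tight_step /= !eqxx.
(* Three further steps round the same clique undo a step, so reachability is invariant in both
   directions. *)
have f_step p q r s : K4 e p q r s -> f (p, q, r) = f (q, r, s).
  move=> K; apply/idP/idP => h; first exact: connect_trans h (connect1 (fstep1 _ _ _ _ K)).
  have K2 : K4 e q r s p by rewrite -K4_rot.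
  have K3 : K4 e r s p q by rewrite -K4_rot.
  have K4' : K4 e s p q r by rewrite -K4_rot.
  apply: connect_trans h (connect_trans (connect1 (fstep1 _ _ _ _ K2)) _).
  exact: connect_trans (connect1 (fstep1 _ _ _ _ K3)) (connect1 (fstep1 _ _ _ _ K4')).
(* The colour of an edge tells whether it is reachable from (a, b, c). *)
pose col p q r := e p q r && f (p, q, r).
have colC p q r : col p q r = col q p r.
  rewrite /col triC; case E: (e q p r) => //=; have [s K] := edge_K4 E.
  by have [-> _ _] := order_invariant f_step K.
have colA p q r : col p q r = col p r q.
  rewrite /col triA; case E: (e p r q) => //=; have [s K] := edge_K4 E.
  by have [_ -> _] := order_invariant f_step K.
have col4 p q r s : K4 e p q r s -> col p q r = col p q s.
  move=> K; have [_ _ E] := order_invariant f_step K; case/and4P: K => h1 h2 h3 h4.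
  by rewrite /col h1 h2 E.
by have := mono_edges dn colC colA col4 e1 e2; rewrite /col e1 e2 /f connect0.
Qed.

End Orders.

(** * The absorbing gadget *)

(* Labels 0-3 are the vertices of a clique, label 4 + i a swapper for the
   labels i and i + 1, label 7 the vertex to be absorbed. One stage turns the
   block [A] into the block in which [x] and [y] have traded places, and keeps
   [B] unchanged, both with the same letters. *)
Definition stage (x y z : nat) (w : seq nat * seq nat * seq nat * seq nat) :=
  let: (A, B, wA, wB) := w in
  let f := if index x A < index y A then x else y in
  let s := if index x A < index y A then y else x in
  let A' := map [fun l => l with f |-> s, s |-> f] A in
  (A', B, wA ++ map [fun l => l with f |-> z, s |-> f] A ++ A',
          wB ++ map [fun l => l with s |-> z] B ++ B).

(** The transpositions 01, 12, 23 compose to the shift l -> l - 1 modulo 4, which turns the block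
    j+1, j+2, j+3, j into j, j+1, j+2, j+3. The first word may thus insert 7 between two runs of the
    three labels other than [j]. In the second word the block is unchanged and its first three
    labels follow directly. *)
Definition gadget_words j :=
  let arr := [seq i %% 4 | i <- iota j.+1 4] in
  let: (_, _, wA, wB) :=
    stage 2 3 6 (stage 1 2 5 (stage 0 1 4 (arr, arr, arr, arr))) in
  (wA ++ 7 :: take 3 arr, wB ++ take 3 arr).

(** The second entry selects a copy in the blow-up and differs for any two positions. It encodes the
    label along with the occurrence number, because different labels may stand for the same sample
    vertex. Words are at most 32 letters long and labels at most 7, whence the 256 copies; 224 is
    the single occurrence of 7. *)
Definition numbered (w : seq nat) :=
  [seq (nth 0 w p, 32 * nth 0 w p + count_mem (nth 0 w p) (take p w))
  | p <- iota 0 (size w)].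
Lemma gadget_words_ok j : j < 4 ->
  let wA := numbered (gadget_words j).1 in
  let wB := numbered (gadget_words j).2 in
  [/\ perm_eq wA ((7, 224) :: wB), take 3 wA = take 3 wB,
      drop (size wA - 3) wA = drop (size wB - 3) wB,
      all (fun lc => (lc.1 < 7) && (lc.2 < 256)) wB &
      uniq (unzip2 wB) && (size wB == 31)].
Proof. by case: j => [|[|[|[|]]]] // _; split; vm_compute. Qed.

Lemma numberedK w : unzip1 (numbered w) = w.
Proof. by rewrite /numbered /unzip1 -map_comp; apply: mkseq_nth. Qed.

Fixpoint win4 (T : Type) (q : T -> T -> T -> T -> bool) (s : seq T) :=
  if s is a :: s' then (if s' is [:: b, c, d & _] then q a b c d else true) && win4 q s'
  else true.

(** The two pieces overlap in three letters, so every window of four lies inside one of them. *)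
Lemma win4_cat (T : Type) (q : T -> T -> T -> T -> bool) s1 a b c s2 :
  win4 q (s1 ++ [:: a, b, c & s2]) =
  win4 q (s1 ++ [:: a; b; c]) && win4 q [:: a, b, c & s2].
Proof.
elim: s1 => [|x s1 IH]; first by [].
rewrite [in LHS]/= [in RHS]/= IH andbA; congr (_ && _); congr (_ && _).
by case: s1 {IH} => [|? [|? [|? ?]]].
Qed.

Lemma win4_rev (T : Type) (q : T -> T -> T -> T -> bool) s :
  (forall a b c d, q a b c d = q d c b a) -> win4 q (rev s) = win4 q s.
Proof.
move=> qr; elim: s => [|a s IH] //.
rewrite rev_cons -cats1; case: s IH => [|b [|c [|d s]]] //.
have -> : rev [:: b, c, d & s] = rev s ++ [:: d; c; b].
  by rewrite !rev_cons -!cats1 -!catA.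
by move=> IH; rewrite -catA win4_cat IH /= qr andbT andbC.
Qed.

Lemma win4_map (T U : Type) (q : T -> T -> T -> T -> bool)
    (q' : U -> U -> U -> U -> bool) (f : T -> U) s :
  (forall a b c d, q a b c d -> q' (f a) (f b) (f c) (f d)) ->
  win4 q s -> win4 q' (map f s).
Proof.
move=> qq; elim: s => [|a s IH] //=; case/andP=> qa /IH ->; rewrite andbT.
by case: s qa {IH} => [|? [|? [|? ?]]] //=; apply: qq.
Qed.

Lemma win4P (T : Type) (q : T -> T -> T -> T -> bool) (s : seq T) :
  win4 q s <-> forall s1 a b c d s2, s = s1 ++ [:: a, b, c, d & s2] -> q a b c d.
Proof.
split=> [+ s1 a b c d s2 E|].
  by rewrite {}E; elim: s1 => [|x s1 IH] /= => /andP [] // _ /IH.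
elim: s => [|a s IH] // h /=; rewrite IH ?andbT => [|s1 x b c d s2 E].
  by case: s {IH} h => [|b [|c [|d s]]] // h; apply: (h [::]).
by apply: (h (a :: s1) _ _ _ _ s2); rewrite E.
Qed.

Definition clique_path (V : finType) (e : triple_system V) := win4 (K4 e).

Section Gadget.
Variables (V : finType) (e : triple_system V).

Lemma K4_sub (T : eqType) (f : T -> V) (a b c d x y z w : T) :
  K4 e (f a) (f b) (f c) (f d) -> uniq [:: x; y; z; w] ->
  all (mem [:: a; b; c; d]) [:: x; y; z; w] -> K4 e (f x) (f y) (f z) (f w).
Proof.
case/and4P=> e1 e2 e3 e4 un /and5P [].
move: un; rewrite !inE /= !inE !negb_or => /and4P [/and3P [n1 n2 n3] /andP [n4 n5] n6 _].
case/or4P=> /eqP X; subst x; case/or4P=> /eqP Y; subst y;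
  rewrite ?eqxx // in n1; case/or4P=> /eqP Z; subst z; rewrite ?eqxx // in n2 n4;
  case/or4P=> /eqP W; subst w; rewrite ?eqxx // in n3 n5 n6; move=> _; K4_sym.
Qed.

(** The base clique, for each swapper the two cliques in which it replaces one label of its pair,
    and the clique of 7 with the labels other than [j]. *)
Definition gadget_cliques j :=
  [:: [:: 0; 1; 2; 3]; [:: 2; 3; 0; 4]; [:: 2; 3; 1; 4]; [:: 0; 3; 1; 5];
      [:: 0; 3; 2; 5]; [:: 0; 1; 2; 6]; [:: 0; 1; 3; 6]; 7 :: rem j (iota 0 4)].

Definition gadget_window j a b c d :=
  uniq [:: a; b; c; d] &&
  has (fun Q => all (mem Q) [:: a; b; c; d]) (gadget_cliques j).

Lemma gadget_windows j : j < 4 ->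
  win4 (gadget_window j) (gadget_words j).1 && win4 (gadget_window j) (gadget_words j).2.
Proof. by case: j => [|[|[|[|]]]] // _; vm_compute. Qed.

Definition gadget_core (h : nat -> V) :=
  [/\ K4 e (h 0) (h 1) (h 2) (h 3), swapper e (h 2) (h 3) (h 0) (h 1) (h 4),
      swapper e (h 0) (h 3) (h 1) (h 2) (h 5) & swapper e (h 0) (h 1) (h 2) (h 3) (h 6)].

Definition others j i := nth 0 (rem j (iota 0 4)) i.

Lemma gadget_path h j : j < 4 -> gadget_core h ->
  K4 e (h 7) (h (others j 0)) (h (others j 1)) (h (others j 2)) ->
  clique_path e (map h (gadget_words j).1) /\ clique_path e (map h (gadget_words j).2).
Proof.
move=> j4; case=> [/and4P [e1 e2 e3 e4] /and5P [f1 f2 f3 f4 f5] /and5P [g1 g2 g3 g4 g5]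
  /and5P [k1 k2 k3 k4 k5]] K.
have win a b c d : gadget_window j a b c d -> K4 e (h a) (h b) (h c) (h d).
  case/andP=> un /hasP [Q Qin allQ].
  suff [q0 [q1 [q2 [q3 [QE KQ]]]]] : exists q0 q1 q2 q3,
      Q = [:: q0; q1; q2; q3] /\ K4 e (h q0) (h q1) (h q2) (h q3).
    by rewrite QE in allQ; apply: K4_sub KQ un allQ.
  move: Qin; rewrite !inE; do 7?[case/orP => [/eqP ->|];
    first by do 4!eexists; split; [reflexivity | K4_sym]].
  move=> /eqP ->; do 4!eexists; split; last exact: K.
  by case: (j) j4 => [|[|[|[|]]]].
by have /andP [w1 w2] := gadget_windows j4; split; [apply: win4_map w1 | apply: win4_map w2].
Qed.

(** The edge is completed to a clique by some [d], and the clique is arranged along its Hamiltonian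
    path of swaps; [j] is the place where [d] ends up. *)
Lemma edge_gadget (dn : codense e) a b c : e a b c ->
  exists j (h : nat -> V), [/\ j < 4, gadget_core h &
    perm_eq [seq h i | i <- rem j (iota 0 4)] [:: a; b; c]].
Proof.
move=> eabc; have [d K] := edge_K4 dn eabc.
have [g0 [g1 [g2 [g3 [pm Kg /existsP [z0 s0] /existsP [z1 s1] /existsP [z2 s2]]]]]] :=
  swappable_path dn K.
pose h i := nth a [:: g0; g1; g2; g3; z0; z1; z2] i.
have dg : d \in [:: g0; g1; g2; g3] by rewrite (perm_mem pm) !inE eqxx !orbT.
exists (index d [:: g0; g1; g2; g3]), h; split; first by rewrite -index_mem in dg.
  by split.
have ua : uniq [:: a; b; c; d].
  case/and4P: K => /tri_neq [n1 n2 n3] /tri_neq [_ n4 n5] /tri_neq [_ _ n6] _.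
  by rewrite /= !inE !negb_or n1 n2 n3 n4 n5 n6.
have -> : [seq h i | i <- rem (index d [:: g0; g1; g2; g3]) (iota 0 4)] =
          rem d [:: g0; g1; g2; g3].
  move: ua; rewrite -(perm_uniq pm) /= !inE !negb_or.
  case/and4P=> /and3P [n1 n2 n3] /andP [n4 n5] n6 _.
  move: dg; rewrite !inE => /or4P [] /eqP ->; rewrite ?eqxx ?(negbTE n1) ?(negbTE n2)
    ?(negbTE n3) ?(negbTE n4) ?(negbTE n5) ?(negbTE n6) //.
have : perm_eq (d :: rem d [:: g0; g1; g2; g3]) (d :: [:: a; b; c]).
  rewrite -(permPl (perm_to_rem dg)) (permPl pm).
  by rewrite -[[:: a; b; c; d]]/([:: a; b; c] ++ [:: d]) perm_catC.
by rewrite perm_cons.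
Qed.

End Gadget.

Import Order.TTheory GRing.Theory Num.Theory.
Local Open Scope ring_scope.

(** * Sums over tuples and boxes *)

Lemma eventually_ge (R : realType) (x : R) :
  exists n0 : nat, forall n, (n0 <= n)%N -> x <= n%:R.
Proof.
exists (Num.bound `|x|) => n le; apply: le_trans (ler_norm x) _.
by apply: le_trans (ltW (archi_boundP (normr_ge0 x))) _; rewrite ler_nat.
Qed.

Lemma card_natr (R : realType) (T : finType) (B : {set T}) :
  #|B|%:R = \sum_x (x \in B)%:R :> R.
Proof.
rewrite -sum1_card natr_sum big_mkcond /=; apply: eq_bigr => x _.
by case: (x \in B).
Qed.

Section TupleSum.
Variable R : realType.

Fixpoint tsum (A : finType) m (F : seq A -> R) : R :=
  if m is m'.+1 then \sum_(x : A) tsum m' (fun s => F (x :: s)) else F [::].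

Variable A : finType.
Implicit Types (m : nat) (F G : seq A -> R).

Lemma eq_tsum m F G : (forall s, size s = m -> F s = G s) -> tsum m F = tsum m G.
Proof.
elim: m F G => [|m IH] F G h /=; first exact: h.
by apply: eq_bigr => x _; apply: IH => s sz; apply: h; rewrite /= sz.
Qed.

Lemma ler_tsum m F G : (forall s, size s = m -> F s <= G s) -> tsum m F <= tsum m G.
Proof.
elim: m F G => [|m IH] F G h /=; first exact: h.
by apply: ler_sum => x _; apply: IH => s sz; apply: h; rewrite /= sz.
Qed.

Lemma tsum_sum (I : Type) (r : seq I) (P : pred I) m (F : I -> seq A -> R) :
  tsum m (fun s => \sum_(i <- r | P i) F i s) = \sum_(i <- r | P i) tsum m (F i).
Proof.
elim: m F => [|m IH] F //=.
by rewrite exchange_big /=; apply: eq_bigr => x _; apply: IH.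
Qed.

Lemma tsumD m F G : tsum m (fun s => F s + G s) = tsum m F + tsum m G.
Proof.
elim: m F G => [|m IH] F G //=.
by rewrite -big_split; apply: eq_bigr => x _; apply: IH.
Qed.

Lemma tsumZ m c F : tsum m (fun s => c * F s) = c * tsum m F.
Proof.
elim: m F => [|m IH] F //=.
by rewrite big_distrr; apply: eq_bigr => x _; apply: IH.
Qed.

Lemma tsum_const m c : tsum m (fun _ : seq A => c) = #|A|%:R ^+ m * c.
Proof.
elim: m => [|m IH] /=; first by rewrite expr0 mul1r.
by rewrite IH sumr_const exprS -[LHS]mulr_natl mulrA.
Qed.

Lemma tsum_ge0 m F : (forall s, 0 <= F s) -> 0 <= tsum m F.
Proof.
move=> h; have := @ler_tsum m (fun => 0) F (fun s _ => h s).
by rewrite tsum_const mulr0.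
Qed.

Lemma tsum_gt0 m F : 0 < tsum m F -> exists2 s, size s = m & 0 < F s.
Proof.
elim: m F => [|m IH] F /= h; first by exists [::].
have [x /IH [s sz hs]] : exists x, 0 < tsum m (fun s => F (x :: s)).
  apply/existsP; apply: contraLR h; rewrite negb_exists => /forallP h.
  by rewrite -leNgt sumr_le0 // => x _; rewrite leNgt h.
by exists (x :: s); rewrite //= sz.
Qed.

Lemma tsum_cat m k F :
  tsum (m + k) F = tsum m (fun s => tsum k (fun s' => F (s ++ s'))).
Proof. by elim: m F => [|m IH] F //=; apply: eq_bigr => x _; rewrite IH. Qed.

Lemma tsum_prod x0 m (g : nat -> A -> R) :
  tsum m (fun s => \prod_(k < m) g k (nth x0 s k)) = \prod_(k < m) \sum_v g k v.
Proof.
elim: m g => [|m IH] g /=; first by rewrite !big_ord0.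
rewrite big_ord_recl /= big_distrl /=; apply: eq_bigr => x _.
rewrite -(IH (fun k => g k.+1)) -tsumZ; apply: eq_tsum => s _.
by rewrite big_ord_recl.
Qed.

Lemma tsum_avg m F a : (0 < #|A|)%N -> a * #|A|%:R ^+ m <= tsum m F ->
  exists2 s, size s = m & a <= F s.
Proof.
move=> A0; elim: m F a => [|m IH] F a /=; first by rewrite expr0 mulr1; exists [::].
move=> h; have [x /IH [s sz hs]] : exists x, a * #|A|%:R ^+ m <= tsum m (fun s => F (x :: s)).
  apply/existsP; apply: contraLR h; rewrite negb_exists -ltNge => /forallP h.
  apply: lt_le_trans (_ : \sum_(x : A) (a * #|A|%:R ^+ m) <= _).
    have [y _] : exists y : A, y \in A by apply/card_gt0P.
    by apply: ltr_sum => [|x _]; [apply/hasP; exists y; rewrite ?mem_index_enum | rewrite ltNge].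
  by rewrite sumr_const -[leLHS]mulr_natl exprS mulrCA.
by exists (x :: s); rewrite //= sz.
Qed.

End TupleSum.

Section Box.
Variable R : realType.

(** A complete multipartite configuration: one part of [t] distinct vertices per coordinate, with
    [P] on every transversal. Disjointness of the parts is left to [P]; see [box_injective]. *)
Fixpoint box (V : finType) t (P : seq V -> bool) (X : seq {ffun 'I_t -> V}) :=
  if X is x :: X' then
    injectiveb x && box (fun s => [forall i, P (x i :: s)]) X'
  else P [::].

Lemma boxP (V : finType) t P (X : seq {ffun 'I_t -> V})
    (x0 : {ffun 'I_t -> V}) (ch : nat -> 'I_t) :
  box P X -> P (mkseq (fun i => (nth x0 X i : {ffun 'I_t -> V}) (ch i)) (size X)).
Proof.
elim: X P ch => [|x X IH] P ch //= /andP [_ /(IH _ (ch \o succn)) /forallP /(_ (ch 0))].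
congr (is_true (P _)); rewrite /mkseq /= -(addn0 1%N) iotaDl -map_comp.
by congr (_ :: _); apply: eq_map.
Qed.

Lemma box_inj (V : finType) t P (X : seq {ffun 'I_t -> V}) :
  box P X -> all (fun x : {ffun 'I_t -> V} => injectiveb x) X.
Proof. by elim: X P => [|x X IH] P //= /andP [-> /IH]. Qed.

Lemma ffact_lower t d : ((d - t) ^ t <= d ^_ t)%N.
Proof.
rewrite ffact_prod; have -> : ((d - t) ^ t = \prod_(i < t) (d - t))%N.
  by rewrite prod_nat_const card_ord.
by apply: leq_prod => i _; rewrite leq_sub2l // ltnW.
Qed.

(* Erdos' theorem on complete partite subhypergraphs, in counting form. *)
Lemma box_dense m t (c : R) : 0 < c -> exists c' : R, 0 < c' /\
  exists n0 : nat, forall V : finType, (n0 <= #|V|)%N ->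
  forall P : seq V -> bool, c * #|V|%:R ^+ m <= tsum m (fun s => (P s)%:R) ->
  c' * (#|V| ^ t)%:R ^+ m <= tsum m (fun X : seq {ffun 'I_t -> V} => (box P X)%:R).
Proof.
elim: m c => [|m IH] c c0.
  exists 1; split=> //; exists 0%N => V _ P /=; rewrite !expr0 !mulr1.
  by case: (P _) => // /(lt_le_trans c0); rewrite ltxx.
pose c1 := (c / 2) * (c / 4) ^+ t.
have c1_gt0 : 0 < c1 by rewrite mulr_gt0 ?exprn_gt0 ?divr_gt0.
have [c2 [c2_gt0 [n1 Hn1]]] := IH (c1 / 2) ltac:(by rewrite divr_gt0).
have [n2 Hn2] := eventually_ge (4 * t%:R / c).
exists (c1 / 2 * c2); split; first by rewrite mulr_gt0 ?divr_gt0.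
exists (maxn 1 (maxn n1 n2)) => V; rewrite !geq_max => /and3P [V1 Vn1 Vn2] P dens.
pose n : R := #|V|%:R.
have n_gt0 : 0 < n by rewrite ltr0n.
have big_n : 4 * t%:R <= c * n by rewrite [c * n]mulrC -ler_pdivrMr //; exact: Hn2.
pose D s := [set v | P (v :: s)].
have sumD : c * n ^+ m.+1 <= tsum m (fun s => #|D s|%:R).
  apply: le_trans dens _; rewrite /= -tsum_sum; apply: ler_tsum => s _.
  by rewrite card_natr; apply: ler_sum => v _; rewrite inE.
(* Averaging: tails with fewer than half the average number of heads contribute at most half of the
   sum. *)
have manyD : c / 2 * n ^+ m <= tsum m (fun s => (c / 2 * n <= #|D s|%:R)%R%:R).
  have le (s : seq V) :
      #|D s|%:R <= n * (c / 2 * n <= #|D s|%:R)%R%:R + c / 2 * n :> R.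
    have : #|D s|%:R <= n by rewrite ler_nat max_card.
    have : 0 <= c / 2 * n by rewrite mulr_ge0 ?divr_ge0 ?ltW.
    by case: (leP (c / 2 * n) #|D s|%:R) => h h1 h2 /=; rewrite ?mulr1 ?mulr0; lra.
  have := le_trans sumD (@ler_tsum R V m (fun s => _) (fun s => _) (fun s _ => le s)).
  rewrite tsumD tsumZ tsum_const -/n => h.
  rewrite -(ler_pM2l n_gt0); move: h; rewrite exprS.
  by set T := tsum _ _; set N := n ^+ m; lra.
pose G (x : {ffun 'I_t -> V}) : R :=
  tsum m (fun s => (injectiveb x && [forall i, P (x i :: s)])%:R).
(* A rich tail [s] admits at least (|D s| - t)^t injective heads, and [big_n] makes |D s| - t at
   least cn/4. *)
have sumG : c1 * n ^+ t * n ^+ m <= \sum_x G x.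
  rewrite -tsum_sum; have -> : c1 * n ^+ t * n ^+ m = (c / 4 * n) ^+ t * (c / 2 * n ^+ m).
    rewrite /c1 [in RHS]exprMn; move: (_ ^+ t) (n ^+ t) (n ^+ m) => x y z; ring.
  apply: le_trans (_ : (c / 4 * n) ^+ t * tsum m (fun s => (c / 2 * n <= #|D s|%:R)%R%:R) <= _).
    by rewrite ler_wpM2l // exprn_ge0 // mulr_ge0 ?divr_ge0 ?ltW.
  rewrite -tsumZ; apply: ler_tsum => s _.
  have -> : \sum_(x : {ffun 'I_t -> V}) (injectiveb x && [forall i, P (x i :: s)])%:R
            = (#|D s| ^_ t)%:R :> R.
    rewrite -[in RHS](card_ord t) -card_inj_ffuns_on card_natr.
    apply: eq_bigr => x _; rewrite !inE andbC; congr (_ && _)%:R.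
    have -> : [forall i, P (x i :: s)] = (x \in ffun_on (mem (D s))).
      by apply/forallP/ffun_onP => h i; have := h i; rewrite inE.
    by [].
  case: (leP (c / 2 * n) #|D s|%:R) => hD; last by rewrite mulr0.
  rewrite mulr1; apply: le_trans (_ : ((#|D s| - t) ^ t)%:R <= _); last by rewrite ler_nat ffact_lower.
  have cn0 : 0 <= c / 4 * n by rewrite ltW // mulr_gt0 ?divr_gt0.
  rewrite natrX; apply: lerXn2r; rewrite ?nnegrE //.
  have t0 : 0 <= t%:R :> R by [].
  have tD : (t <= #|D s|)%N by rewrite -(ler_nat R); lra.
  by rewrite natrB //; lra.
have G_le x : G x <= n ^+ m.
  rewrite -[n ^+ m]mulr1 -tsum_const; apply: ler_tsum => s _.
  by case: (_ && _).
have manyG : c1 / 2 * n ^+ t <= \sum_x (c1 / 2 * n ^+ m <= G x)%R%:R.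
  have le x : G x <= n ^+ m * (c1 / 2 * n ^+ m <= G x)%R%:R + c1 / 2 * n ^+ m.
    have := G_le x; have : 0 <= c1 / 2 * n ^+ m.
      by rewrite mulr_ge0 ?divr_ge0 ?exprn_ge0 ?ltW.
    by case: (leP (c1 / 2 * n ^+ m) (G x)) => h h1 h2 /=; rewrite ?mulr1 ?mulr0; lra.
  have : c1 * n ^+ t * n ^+ m <=
      \sum_x (n ^+ m * (c1 / 2 * n ^+ m <= G x)%R%:R + c1 / 2 * n ^+ m).
    by apply: le_trans sumG _; apply: ler_sum => x _.
  rewrite big_split /= -big_distrr /= sumr_const card_ffun card_ord => h.
  have nm : 0 < n ^+ m by rewrite exprn_gt0.
  rewrite -(ler_pM2l nm); move: h; rewrite -[_ *+ (_ ^ _)]mulr_natl natrX -/n.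
  by set T := \sum_x _; set N := n ^+ m; set N' := n ^+ t; lra.
rewrite /= exprS natrX -/n.
(* The induction hypothesis is applied to the common link of each rich head [x]. *)
apply: le_trans (_ : \sum_x (c1 / 2 * n ^+ m <= G x)%R%:R * (c2 * (n ^+ t) ^+ m) <= _).
  rewrite -big_distrl /=; set S := \sum_x _ in manyG *.
  have -> : c1 / 2 * c2 * (n ^+ t * (n ^+ t) ^+ m) = c1 / 2 * n ^+ t * (c2 * (n ^+ t) ^+ m) by ring.
  by rewrite ler_wpM2r // mulr_ge0 ?ltW // !exprn_gt0.
apply: ler_sum => x _; case: (leP (c1 / 2 * n ^+ m) (G x)) => hG; last first.
  by rewrite mul0r tsum_ge0.
rewrite mul1r; have inj : injectiveb x.
  apply: contraLR hG => /negbTE ninj; rewrite -ltNge /G ninj /= tsum_const mulr0.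
  by rewrite mulr_gt0 ?divr_gt0 ?exprn_gt0.
have := Hn1 V Vn1 (fun s => [forall i, P (x i :: s)]).
rewrite natrX -/n inj /=; apply.
by apply: le_trans hG _; rewrite /G inj.
Qed.

End Box.

(** * Random samples inherit the codegree condition *)

Section Sampling.
Variable R : realType.

Lemma bernoulli (x : R) k : x <= 1 -> 1 - k%:R * x <= (1 - x) ^+ k.
Proof.
move=> x1; elim: k => [|k IH]; first by rewrite mul0r subr0 expr0.
rewrite exprS -natr1; apply: le_trans (_ : (1 - x) * (1 - k%:R * x) <= _).
  have : 0 <= k%:R * x ^+ 2 by rewrite mulr_ge0 ?sqr_ge0.
  by rewrite expr2; nra.
by rewrite ler_wpM2l // subr_ge0.
Qed.

Lemma bonferroni (x : R) k : 0 <= x <= 1 ->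
  (1 - x) ^+ k <= 1 - k%:R * x + 'C(k, 2)%:R * x ^+ 2.
Proof.
case/andP=> x0 x1; elim: k => [|k IH]; first by rewrite expr0 bin0n /= !mul0r subr0 addr0.
rewrite exprS binS bin1 natrD -natr1.
apply: le_trans (_ : (1 - x) * (1 - k%:R * x + 'C(k, 2)%:R * x ^+ 2) <= _).
  by rewrite ler_wpM2l // subr_ge0.
have : 0 <= 'C(k, 2)%:R * x ^+ 3 by rewrite mulr_ge0 ?exprn_ge0.
by rewrite !exprS expr0; move: 'C(k, 2)%:R k%:R => c d; nra.
Qed.

(** With 1/q = 1 + u, Bernoulli's inequality gives (k u)^3 q^(3k) <= 1, and cubic decay beats the
    square. For r = 3k the base 27k + 2 is at most 29k, and 841 is 29^2. *)
Lemma poly_exp_decay (C q eps : R) : 0 < C -> 0 < q < 1 -> 0 < eps ->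
  exists r, (0 < r)%N /\ C * (9 * r + 2)%:R ^+ 2 * q ^+ r <= eps.
Proof.
move=> C0 /andP [q0 q1] e0; pose u := q^-1 - 1.
have u0 : 0 < u by rewrite subr_gt0 invf_gt1.
have [k0 Hk] := eventually_ge (841 * C / (u ^+ 3 * eps)).
pose k := k0.+1; exists (3 * k)%N; split=> //.
have kb : 841 * C <= k%:R * (u ^+ 3 * eps).
  by rewrite -ler_pdivrMr ?mulr_gt0 ?exprn_gt0 // Hk // /k.
have k_gt0 : 0 < k%:R :> R by rewrite ltr0n.
have qk : (k%:R * u) ^+ 3 * q ^+ (3 * k) <= 1.
  rewrite mulnC exprM -exprMn exprn_ile1 //.
    by rewrite !mulr_ge0 ?exprn_ge0 ?ltW.
  have := @bernoulli (- u) k; rewrite opprK => /(_ ltac:(lra)) h.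
  have -> : q = (1 + u)^-1 by rewrite /u addrC subrK invrK.
  by rewrite exprVn ler_pdivrMr ?exprn_gt0 //; lra.
have sq : (9 * (3 * k) + 2)%:R ^+ 2 <= 841 * k%:R ^+ 2 :> R.
  apply: le_trans (_ : (29 * k)%:R ^+ 2 <= _).
    have le29 l : (0 < l -> 9 * (3 * l) + 2 <= 29 * l)%N.
      by move=> l0; rewrite mulnA -[29%N]/(9 * 3 + 2)%N mulnDl leq_add2l leq_pmulr.
    by rewrite lerXn2r ?nnegrE // ler_nat le29.
  by rewrite natrM exprMn; have -> : 29 ^+ 2 = 841 :> R by ring.
have qk0 : 0 < q ^+ (3 * k) by rewrite exprn_gt0.
apply: le_trans (_ : C * (841 * k%:R ^+ 2) * q ^+ (3 * k) <= _).
  by apply: ler_wpM2r; [exact: ltW | apply: ler_wpM2l => //; exact: ltW].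
rewrite -(ler_pM2l (_ : 0 < k%:R * u ^+ 3)) ?mulr_gt0 ?exprn_gt0 //.
move: kb qk; rewrite exprMn; set Q := q ^+ _; set U := u ^+ 3 => kb qk.
have U0 : 0 < U by rewrite exprn_gt0.
apply: le_trans (_ : 841 * C * (k%:R ^+ 3 * U * Q) <= _).
  by rewrite le_eqVlt; apply/orP; left; apply/eqP; rewrite !exprS expr0; ring.
apply: le_trans (_ : 841 * C <= _); last by apply: le_trans kb _; rewrite mulrA.
by rewrite -[leRHS]mulr1 ler_wpM2l // mulr_ge0 // ltW.
Qed.

Lemma prod_two m (i j : 'I_m) (a b c : R) : i != j ->
  \prod_(k < m) (if k == i then a else if k == j then b else c) = a * b * c ^+ (m - 2).
Proof.
move=> ij; rewrite (bigD1 i) //= eqxx (bigD1 j) /=; last by rewrite eq_sym.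
rewrite eqxx.
rewrite [j == i]eq_sym (negbTE ij) mulrA; congr (_ * _).
rewrite (eq_bigr (fun=> c)) => [|k /andP [/negbTE -> /negbTE ->]] //.
rewrite prodr_const; congr (_ ^+ _).
rewrite -[X in (X - 2)%N](card_ord m) -(cardC (pred2 i j)) card2 ij addKn.
by apply: eq_card => k; rewrite !inE negb_or.
Qed.

Section Pairs.
Variables (V : finType) (x0 : V).

(** Indicators fix the entries at [i] and [j]; for fixed values the sum factors over the remaining m
    - 2 coordinates. *)
Lemma tsum_pair m (i j : 'I_m) (Q : V -> V -> R) (K : V -> V -> V -> R) : i != j ->
  tsum m (fun s => Q (nth x0 s i) (nth x0 s j) *
    \prod_(k < m | (k != i) && (k != j)) K (nth x0 s i) (nth x0 s j) (nth x0 s k))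
  = \sum_x \sum_y Q x y * (\sum_v K x y v) ^+ (m - 2).
Proof.
move=> ij; pose g x y (k : nat) v : R :=
  if k == i then (v == x)%:R else if k == j then (v == y)%:R else K x y v.
transitivity (tsum m (fun s => \sum_x \sum_y Q x y * \prod_(k < m) g x y k (nth x0 s k))).
  apply: eq_tsum => s _; set a := nth x0 s i; set b := nth x0 s j.
  have gE x y : \prod_(k < m) g x y k (nth x0 s k) =
      (a == x)%:R * ((b == y)%:R *
       \prod_(k < m | (k != i) && (k != j)) K x y (nth x0 s k)).
    rewrite (bigD1 i) //= {1}/g eqxx (bigD1 j) /=; last by rewrite eq_sym.
    have nji : (j == i :> nat) = false by rewrite eq_sym; apply: negbTE.
    rewrite {1}/g nji eqxx; congr (_ * (_ * _)).
    apply: eq_bigr => k /andP [ki kj]; rewrite /g.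
    by move: ki kj; rewrite -!val_eqE /= => /negbTE -> /negbTE ->.
  rewrite (bigD1 a) //= (bigD1 b) //= gE !eqxx !mul1r.
  rewrite [X in _ + X + _]big1 => [|y /negbTE nb]; last first.
    by rewrite gE [b == y]eq_sym nb mul0r !mulr0.
  rewrite [X in _ + X]big1 ?addr0 // => x /negbTE na.
  by apply: big1 => y _; rewrite gE [a == x]eq_sym na mul0r mulr0.
rewrite tsum_sum; apply: eq_bigr => x _; rewrite tsum_sum; apply: eq_bigr => y _.
rewrite tsumZ tsum_prod; congr (_ * _).
have one z : \sum_v (v == z)%:R = 1 :> R.
  by rewrite (bigD1 z) //= eqxx big1 ?addr0 // => v /negbTE ->.
transitivity (1 * 1 * (\sum_v K x y v) ^+ (m - 2)); last by rewrite !mul1r.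
rewrite -(prod_two _ _ _ ij).
apply: eq_bigr => k _; rewrite /g -!val_eqE /=.
by case: eqP => _; [exact: one | case: eqP => _; [exact: one |]].
Qed.

Definition good_sample (e : triple_system V) (s : seq V) :=
  uniq s && all (fun x => all (fun y =>
    (x == y) || (7 * size s < 9 * count (e x y) s)%N) s) s.

Lemma count_nth m (P : pred V) (s : seq V) : size s = m ->
  count P s = (\sum_(k < m) P (nth x0 s k))%N.
Proof.
move=> <-; rewrite -sum1_count big_mkcond (big_nth x0) big_mkord.
by apply: eq_bigr => k _; case: (P _).
Qed.

(* Chernoff's bound: the weight (1 - t) ^ count penalises large links. *)
Lemma tsum_bad_pair r (i j : 'I_(9 * r + 2)) (e : triple_system V) (d t : R) :
  i != j -> 0 < t < 1 -> t * d <= 1 ->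
  (forall x y, x != y -> d * #|V|%:R <= #|nbr e x y|%:R) ->
  tsum (9 * r + 2) (fun s : seq V => ((nth x0 s i != nth x0 s j) &&
      (9 * count (e (nth x0 s i) (nth x0 s j)) s <= 7 * size s)%N)%:R)
  <= #|V|%:R ^+ (9 * r + 2) * (((1 - t * d) ^+ 9 / (1 - t) ^+ 7) ^+ r / (1 - t) ^+ 2).
Proof.
move=> ij /andP [t0 t1] td deg; set m := (9 * r + 2)%N; pose l := 1 - t.
have l0 : 0 < l by rewrite subr_gt0.
have l1 : l <= 1 by rewrite /l; lra.
pose n : R := #|V|%:R.
have n0 : 0 <= n by [].
pose K x y v := l ^+ e x y v.
pose Q (x y : V) : R := (x != y)%:R.
(* For a bad pair at most 7r + 2 entries lie in its link, so the product of weights is at least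
   [l ^+ (7 * r + 2)]. Size 9r + 2 leaves 9r free entries, which explains the exponents 9 and 7 in
   the bound. *)
apply: le_trans (_ : (l ^+ (7 * r + 2))^-1 * tsum m (fun s => Q (nth x0 s i) (nth x0 s j) *
    \prod_(k < m | (k != i) && (k != j)) K (nth x0 s i) (nth x0 s j) (nth x0 s k)) <= _).
  rewrite -tsumZ; apply: ler_tsum => s sz; rewrite /Q.
  case: (_ != _) => /=; last by rewrite mul0r mulr0.
  rewrite mul1r /K prodrXr; set c := (\sum_(_ < _ | _) _)%N.
  have [le|_] := leqP; last by rewrite mulr_ge0 ?invr_ge0 ?exprn_ge0 ?ltW.
  have cle : (c <= 7 * r + 2)%N.
    have : (c <= count (e (nth x0 s i) (nth x0 s j)) s)%N.
      rewrite (count_nth _ sz) /c big_mkcond; apply: leq_sum => k _.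
      by case: ifP.
    by rewrite sz /m in le; move: le; move: c (count _ _) => a b; lia.
  rewrite mulrC ler_pdivlMr ?exprn_gt0 // mul1r.
  by apply: ler_wiXn2l; rewrite // ltW.
rewrite tsum_pair //.
have sumK x y : x != y -> \sum_v K x y v <= (1 - t * d) * n.
  move=> xy; have -> : \sum_v K x y v = n - t * #|nbr e x y|%:R.
    rewrite card_natr mulr_sumr /n -sum1_card natr_sum -sumrB.
    apply: eq_bigr => v _; rewrite /K !inE /l.
    by case: (e x y v); rewrite ?expr1 ?expr0 ?mulr1 ?mulr0 ?subr0.
  have := deg x y xy; rewrite -/n => h.
  rewrite mulrBl mul1r lerB // -mulrA ler_wpM2l // ltW //.
have le1 : \sum_x \sum_y Q x y * (\sum_v K x y v) ^+ (m - 2) <=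
    n ^+ m * (1 - t * d) ^+ (m - 2).
  have -> : n ^+ m * (1 - t * d) ^+ (m - 2) =
      \sum_(x : V) \sum_(y : V) ((1 - t * d) * n) ^+ (m - 2).
    have sc (c : R) : \sum_(x : V) c = n * c by rewrite sumr_const -[LHS]mulr_natl.
    rewrite sc sc exprMn mulrA mulrA.
    have -> : n ^+ m = n * n * n ^+ (m - 2) by rewrite -mulrA -!exprS /m addnK addn2.
    by rewrite -!mulrA; congr (_ * (_ * _)); rewrite mulrC.
  apply: ler_sum => x _; apply: ler_sum => y _; rewrite /Q.
  have ge0 : 0 <= (1 - t * d) * n by rewrite mulr_ge0 // subr_ge0.
  case: eqVneq => xy; first by rewrite mul0r exprn_ge0.
  rewrite mul1r; apply: lerXn2r; rewrite ?nnegrE //; last exact: sumK.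
  by apply: sumr_ge0 => v _; rewrite exprn_ge0 // ltW.
apply: le_trans (ler_wpM2l _ le1) _; first by rewrite invr_ge0 exprn_ge0 // ltW.
rewrite -/n /m addnK -/l le_eqVlt; apply/orP; left; apply/eqP.
rewrite mulrCA; congr (_ * _); rewrite exprD invfM [in RHS]expr_div_n -!exprM mulrC.
by rewrite mulrA.
Qed.

Lemma tsum_collision m (i j : 'I_m) : i != j ->
  tsum m (fun s : seq V => (nth x0 s i == nth x0 s j)%:R) =
    #|V|%:R * #|V|%:R ^+ (m - 2) :> R.
Proof.
move=> ij; have := tsum_pair (fun x y => (x == y)%:R) (fun _ _ _ => 1) ij.
rewrite (eq_tsum (G := fun s => (nth x0 s i == nth x0 s j)%:R)); last first.
  by move=> s _; rewrite big1 ?mulr1.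
move=> ->; transitivity (\sum_(x : V) #|V|%:R ^+ (m - 2) : R).
  apply: eq_bigr => x _; rewrite (bigD1 x) //= eqxx mul1r sumr_const.
  by rewrite big1 ?addr0 // => y /negbTE; rewrite eq_sym => ->; rewrite mul0r.
by rewrite sumr_const -[LHS]mulr_natl.
Qed.

Lemma bad_sample_le m (e : triple_system V) (s : seq V) : size s = m ->
  (~~ good_sample e s)%:R <= \sum_(i < m) \sum_(j < m | i != j)
    ((nth x0 s i == nth x0 s j)%:R + ((nth x0 s i != nth x0 s j) &&
      (9 * count (e (nth x0 s i) (nth x0 s j)) s <= 7 * size s)%N)%:R) :> R.
Proof.
move=> sz; pose F (i j : 'I_m) : R := (nth x0 s i == nth x0 s j)%:R +
  ((nth x0 s i != nth x0 s j) &&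
      (9 * count (e (nth x0 s i) (nth x0 s j)) s <= 7 * size s)%N)%:R.
suff: (~~ good_sample e s)%:R <= \sum_(i < m) \sum_(j < m | i != j) F i j by [].
have F0 i j : 0 <= F i j by rewrite /F addr_ge0.
have big i j : i != j -> 1 <= F i j -> 1 <= \sum_(i < m) \sum_(j < m | i != j) F i j.
  move=> ij h; rewrite (bigD1 i) //= (bigD1 j) //= -addrA ler_wpDr //.
  by rewrite addr_ge0 ?sumr_ge0 // => k _; rewrite sumr_ge0.
case: (boolP (good_sample e s)) => [_|] /=.
  by apply: sumr_ge0 => i _; apply: sumr_ge0.
rewrite negb_and => /orP [/(uniqPn x0) [i [j [ij js eq]]]|].
  rewrite sz in js; have is_ := ltn_trans ij js.
  apply: (big (Ordinal is_) (Ordinal js)); first by rewrite -val_eqE /= neq_ltn ij.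
  by rewrite /F /= eq eqxx /= addr0.
case/allPn=> x /(nthP x0) [i is_ <-] /allPn [y /(nthP x0) [j js <-]].
rewrite negb_or -leqNgt sz in is_ js * => /andP [ne le].
apply: (big (Ordinal is_) (Ordinal js)).
  by apply: contraNneq ne => -[->].
by rewrite /F /= ne sz le /= (negbTE ne) add0r.
Qed.

End Pairs.

Lemma sampling (alpha eps : R) : 0 < alpha -> 0 < eps ->
  exists m, (6 <= m)%N /\ exists n0 : nat, forall (V : finType) (e : triple_system V),
  (n0 <= #|V|)%N ->
  (forall x y, x != y -> (7 / 9 + alpha) * #|V|%:R <= #|nbr e x y|%:R) ->
  tsum m (fun s : seq V => (~~ good_sample e s)%:R) <= eps * #|V|%:R ^+ m.
Proof.
move=> a0 e0; pose a : R := Order.min alpha (1 / 9).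
have {}a0 : 0 < a by rewrite lt_min a0; lra.
have a1 : a <= 1 / 9 by rewrite ge_min lexx orbT.
have aal : a <= alpha by rewrite ge_min lexx.
(* By [bonferroni] and [bernoulli], [q] is below 1 once 36 (td)^2 < 9td - 7t = 9ta. This holds for t
   = a/8 since d <= 8/9. *)
pose t := a / 8; pose d := 7 / 9 + a.
have t0 : 0 < t < 1 by rewrite /t; lra.
have td : 0 <= t * d <= 1 by rewrite /d /t; nra.
pose q := (1 - t * d) ^+ 9 / (1 - t) ^+ 7.
have l0 : 0 < 1 - t by lra.
have q01 : 0 < q < 1.
  have td1 : 0 < 1 - t * d by rewrite /d /t; nra.
  rewrite divr_gt0 ?exprn_gt0 //= ltr_pdivrMr ?exprn_gt0 // mul1r.
  have h1 := @bernoulli t 7 ltac:(lra); have h2 := @bonferroni (t * d) 9 td.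
  apply: le_lt_trans h2 (lt_le_trans _ h1).
  rewrite -[('C(9, 2))%:R]/(36%:R); rewrite /d /t; nra.
have [r [r0 Hr]] := @poly_exp_decay ((1 - t) ^- 2) q (eps / 2)
  ltac:(by rewrite invr_gt0 exprn_gt0) q01 ltac:(by rewrite divr_gt0).
pose m := (9 * r + 2)%N; exists m; split; first by rewrite /m; move: r0; clear; lia.
have [n1 Hn1] := eventually_ge (m%:R ^+ 2 / (eps / 2)).
exists (maxn 1 n1) => V e; rewrite geq_max => /andP [V0 Vn1] deg.
have [x0 _] : exists x0 : V, x0 \in V by apply/card_gt0P.
pose n : R := #|V|%:R.
have n0 : 0 < n by rewrite ltr0n.
have deg' x y : x != y -> d * n <= #|nbr e x y|%:R.
  by move=> xy; apply: le_trans (deg x y xy); rewrite ler_wpM2r // /d lerD2l.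
pose B := \sum_(i < m) \sum_(j < m | i != j) (n * n ^+ (m - 2) + n ^+ m * (q ^+ r / (1 - t) ^+ 2)).
apply: le_trans (_ : B <= _).
  have := @ler_tsum R V m (fun s => (~~ good_sample e s)%:R) (fun s => _)
            (fun s sz => bad_sample_le x0 e sz).
  move/le_trans; apply; rewrite tsum_sum /B; apply: ler_sum => i _.
  rewrite tsum_sum; apply: ler_sum => j ij; rewrite tsumD tsum_collision // -/n.
  by rewrite lerD2l; apply: tsum_bad_pair => //; case/andP: td.
apply: le_trans (_ : \sum_(i < m) \sum_(j < m) (n * n ^+ (m - 2) + n ^+ m * (q ^+ r / (1 - t) ^+ 2)) <= _).
  apply: ler_sum => i _; rewrite [leRHS](bigID (fun j => i != j)) /=.
  rewrite ler_wpDr // sumr_ge0 // => j _; case/andP: q01 => q0 _.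
  by rewrite ltW // addr_gt0 ?mulr_gt0 ?invr_gt0 ?exprn_gt0.
rewrite !sumr_const !card_ord.
have -> : n * n ^+ (m - 2) = n ^+ m / n.
  have -> : n ^+ m = n * n * n ^+ (m - 2) by rewrite -mulrA -!exprS /m addnK addn2.
  by move: (n ^+ (m - 2)) => M; field; exact: lt0r_neq0.
set N := n ^+ m; have N0 : 0 < N by rewrite exprn_gt0.
rewrite -mulrnA -[leLHS]mulr_natl natrM -expr2.
have h1 : m%:R ^+ 2 / n <= eps / 2.
  by rewrite ler_pdivrMr // mulrC -ler_pdivrMr ?divr_gt0 // Hn1.
have h2 : m%:R ^+ 2 * (q ^+ r / (1 - t) ^+ 2) <= eps / 2.
  by apply: le_trans Hr; rewrite le_eqVlt; apply/orP; left; apply/eqP; rewrite -/m; ring.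
apply: le_trans (_ : N * (m%:R ^+ 2 / n + m%:R ^+ 2 * (q ^+ r / (1 - t) ^+ 2)) <= _).
  by rewrite le_eqVlt; apply/orP; left; apply/eqP; ring.
rewrite [leRHS]mulrC; apply: ler_wpM2l; first exact: ltW.
by apply: le_trans (lerD h1 h2) _; lra.
Qed.

End Sampling.

(** * Letters over samples and boxes *)

Lemma tight_path_word (V : finType) (e : triple_system V) a b c p :
  path (tight_step e) (a, b, c) p ->
  clique_path e ([:: a; b; c] ++ [seq q.2 | q <- p]) /\
  exists s, [:: a; b; c] ++ [seq q.2 | q <- p] =
            s ++ [:: (last (a, b, c) p).1.1; (last (a, b, c) p).1.2; (last (a, b, c) p).2].
Proof.
elim: p a b c => [|[[x y] z] p IH] a b c; first by split=> //; exists [::].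
move=> /= /andP [/and3P [/= /eqP -> /eqP -> K]] /IH [h [s E]]; split.
  by apply/andP; split.
by exists (a :: s); move: E => /= ->.
Qed.

Section Sample.
Variables (V : finType) (e : triple_system V) (x0 : V) (s : seq V).

Lemma sample_subproofC m : forall x y z : 'I_m,
  e (nth x0 s x) (nth x0 s y) (nth x0 s z) = e (nth x0 s y) (nth x0 s x) (nth x0 s z).
Proof. by move=> x y z; apply: triC. Qed.
Lemma sample_subproofA m : forall x y z : 'I_m,
  e (nth x0 s x) (nth x0 s y) (nth x0 s z) = e (nth x0 s x) (nth x0 s z) (nth x0 s y).
Proof. by move=> x y z; apply: triA. Qed.
Lemma sample_subproofI m : forall x y : 'I_m,
  e (nth x0 s x) (nth x0 s x) (nth x0 s y) = false.
Proof. by move=> x y; apply: triI. Qed.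

Definition sample m : triple_system 'I_m :=
  TripleSystem (@sample_subproofC m) (@sample_subproofA m) (@sample_subproofI m).

Lemma sample_codense : good_sample e s -> codense (sample (size s)).
Proof.
case/andP=> us /allP h i j ij; rewrite card_ord.
have /allP := h _ (mem_nth x0 (ltn_ord i)) => /(_ _ (mem_nth x0 (ltn_ord j))).
rewrite nth_uniq // val_eqE (negbTE ij) /= => /leq_trans; apply.
rewrite leq_mul2l /= (count_nth x0 _ (erefl (size s))) -sum1_card [leqRHS]big_mkcond.
by apply: leq_sum => k _; rewrite inE /=; case: (e _ _ _).
Qed.

Lemma sample_clique_path m (u : seq 'I_m) :
  clique_path (sample m) u -> clique_path e [seq nth x0 s i | i : 'I_m <- u].
Proof. by apply: win4_map. Qed.

(** A walk without repeated states visits each ordered triple of the sample at most once, so its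
    length does not depend on |V|. *)
Lemma sample_word m (a b c x y z : 'I_m) : codense (sample m) ->
  sample m a b c -> sample m x y z -> exists2 u : seq 'I_m,
    (size u <= m ^ 3 + 3)%N & [/\ clique_path e [seq nth x0 s i | i : 'I_m <- u],
     exists u', u = [:: a; b; c] ++ u' & exists u', u = u' ++ [:: x; y; z]].
Proof.
move=> dn e1 e2; have /connectP [p0 /shortenP [p pth un _] lst] := tight_connected dn e1 e2.
have [cp [u' uE]] := tight_path_word pth.
exists ([:: a; b; c] ++ [seq q.2 | q <- p]).
  rewrite size_cat size_map addnC leq_add2r.
  have /uniq_leq_size := un => /(_ (enum {: 'I_m * 'I_m * 'I_m})) h.
  have {h} : (size ((a, b, c) :: p) <= size (enum {: 'I_m * 'I_m * 'I_m}))%N.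
    by apply: h => q _; rewrite mem_enum.
  by rewrite -cardE !card_prod card_ord /= => /ltnW; rewrite -!mulnA.
split; first exact: sample_clique_path.
  by exists [seq q.2 | q <- p].
by exists u'; rewrite uE -lst.
Qed.

End Sample.

Section Letters.
Variables (V : finType) (e : triple_system V) (t : nat) (x0 : V).

(* A letter is either a fixed vertex or the [c]-th copy of the [i]-th vertex of
   a sample. *)
Notation letter := (V + nat * 'I_t.+1)%type.

Definition sval (s : nat -> V) (l : letter) : V :=
  match l with inl a => a | inr ic => s ic.1 end.

Definition xval (X : nat -> 'I_t.+1 -> V) (l : letter) : V :=
  match l with inl a => a | inr ic => X ic.1 ic.2 end.

Definition lidx (l : letter) : option nat := if l is inr ic then Some ic.1 else None.
Definition lcopy (l : letter) : 'I_t.+1 := if l is inr ic then ic.2 else ord0.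

(** Under any choice of one copy per index, four consecutive letters give distinct vertices, so
    letters of one window never share an index. A single choice [ch] therefore agrees with all four
    copies demanded by the window. *)
Lemma clique_path_lift (X : nat -> 'I_t.+1 -> V) (W : seq letter) :
  (forall ch : nat -> 'I_t.+1, clique_path e (map (sval (fun i => X i (ch i))) W)) ->
  clique_path e (map (xval X) W).
Proof.
move=> h; apply/win4P => s1 a b c d s2.
move/(f_equal (fun q => (drop (size s1) q))); rewrite drop_size_cat // -map_drop.
case: (drop _ W) (take _ W) (cat_take_drop (size s1) W)
  => [|l1 [|l2 [|l3 [|l4 W']]]] Wt WE //= [<- <- <- <- _].
have K ch : K4 e (sval (fun i => X i (ch i)) l1) (sval (fun i => X i (ch i)) l2)
               (sval (fun i => X i (ch i)) l3) (sval (fun i => X i (ch i)) l4).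
  by apply: ((win4P _ _).1 (h ch) (map _ Wt) _ _ _ _ (map _ W')); rewrite -WE map_cat.
pose ch i := if lidx l1 == Some i then lcopy l1 else if lidx l2 == Some i then lcopy l2
  else if lidx l3 == Some i then lcopy l3 else lcopy l4.
have clash (l l' : letter) : sval (fun i => X i (ch i)) l != sval (fun i => X i (ch i)) l' ->
    forall i, lidx l' == Some i -> (lidx l == Some i) = false.
  move=> ne i /eqP h'; apply/eqP => h1; case/eqP: ne.
  by case: l h1 => [//|[j q]] /= [->]; case: l' h' => [//|[j' q']] /= [->].
have := K ch; have /and4P [/tri_neq [n12 n13 n23] /tri_neq [_ n14 n24]] := K ch.
move=> /tri_neq [_ _ n34] _.
have -> : sval (fun i => X i (ch i)) l1 = xval X l1.
  by case: (l1) @ch {K clash n12 n13 n14 n23 n24 n34} => [//|[j q]] /=; rewrite eqxx.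
have -> : sval (fun i => X i (ch i)) l2 = xval X l2.
  have := clash _ _ n12; rewrite /ch; case: (l2) => [//|[j q]] /= /(_ j (eqxx _)) ->.
  by rewrite eqxx.
have -> : sval (fun i => X i (ch i)) l3 = xval X l3.
  have := clash _ _ n23; have := clash _ _ n13.
  rewrite /ch; case: (l3) => [//|[j q]] /= /(_ j (eqxx _)) -> /(_ j (eqxx _)) ->.
  by rewrite eqxx.
have -> // : sval (fun i => X i (ch i)) l4 = xval X l4.
have := clash _ _ n34; have := clash _ _ n24; have := clash _ _ n14.
rewrite /ch; case: (l4) => [//|[j q]] /= /(_ j (eqxx _)) -> /(_ j (eqxx _)) -> /(_ j (eqxx _)) ->.
by [].
Qed.

End Letters.

Section BoxLetters.
Variables (V : finType) (t : nat) (P : seq V -> bool) (X : seq {ffun 'I_t.+1 -> V}).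
Variable x0 : V.
Let xs (i : nat) (c : 'I_t.+1) : V := nth [ffun=> x0] X i c.
Hypothesis boxX : box P X.

Lemma box_sample (ch : nat -> 'I_t.+1) : P (mkseq (fun i => xs i (ch i)) (size X)).
Proof. exact: boxP. Qed.

Lemma box_entry (Q : pred V) : (forall s, P s -> all Q s) ->
  forall i c, (i < size X)%N -> Q (xs i c).
Proof.
move=> PQ i c lt; have /PQ /allP := box_sample (fun=> c); apply.
by apply/mapP; exists i; rewrite ?mem_iota.
Qed.

(** Entries of one part differ by injectivity; entries of two parts lie on a common transversal,
    which is repetition-free by [P]. *)
Lemma box_injective : (forall s, P s -> uniq s) ->
  forall i c j d, (i < size X)%N -> (j < size X)%N -> xs i c = xs j d -> (i, c) = (j, d).
Proof.
move=> Pu i c j d lti ltj; have [<-|ne] := eqVneq i j.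
  have /(all_nthP [ffun=> x0]) /(_ i lti) /injectiveP inj := box_inj boxX.
  by move=> /inj ->.
pose ch k := if k == i then c else d.
have /Pu /(uniqP x0) := box_sample ch => /(_ i j).
rewrite !inE size_mkseq !nth_mkseq // /ch eqxx eq_sym (negbTE ne).
by move=> /(_ lti ltj) h /h E; rewrite E eqxx in ne.
Qed.

End BoxLetters.

(** * Densities of clique extensions *)

Section Density.
Variables (R : realType) (V : finType) (e : triple_system V) (alpha : R).
Hypothesis a0 : 0 < alpha.
Let n : R := #|V|%:R.
Hypothesis deg : forall x y, x != y -> (7 / 9 + alpha) * n <= #|nbr e x y|%:R.

Let n0 : 0 <= n. Proof. by []. Qed.

(** Inclusion-exclusion on the links of the three pairs: 3 * 7/9 - 2 = 1/3. *)
Lemma K4_count a b c : e a b c -> n / 3 <= \sum_(d : V) (K4 e a b c d)%:R.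
Proof.
move=> eabc; have [n1 n2 n3] := tri_neq eabc.
have := deg n1; have := deg n2; have := deg n3; rewrite !card_natr => h1 h2 h3.
have : \sum_(d : V) ((d \in nbr e a b)%:R + (d \in nbr e a c)%:R + (d \in nbr e b c)%:R - 2)
       <= \sum_(d : V) (K4 e a b c d)%:R :> R.
  apply: ler_sum => d _; rewrite !inE /K4 eabc /=.
  by case: (e a b d); case: (e a c d); case: (e b c d) => /=; lra.
rewrite !big_split /= sumr_const -[X in _ + X <= _]mulr_natr -/n.
have : 0 <= alpha * n by rewrite mulr_ge0 // ltW.
by rewrite !mulrDl in h1 h2 h3; lra.
Qed.

Lemma extension_density k a b c : e a b c ->
  (n / 3) ^+ k <= tsum k (fun s => (clique_path e [:: a, b, c & s])%:R).
Proof.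
elim: k a b c => [|k IH] a b c eabc; first by rewrite expr0.
rewrite exprS /=; apply: le_trans (_ : \sum_(d : V) (K4 e a b c d)%:R * (n / 3) ^+ k <= _).
  by rewrite -mulr_suml ler_wpM2r ?exprn_ge0 ?divr_ge0 // K4_count.
apply: ler_sum => d _; case K: (K4 e a b c d); last first.
  by rewrite mul0r tsum_ge0.
rewrite mul1r; apply: le_trans (IH b c d _) _; first by case/and4P: K.
by apply: ler_tsum => s _; rewrite {2}/clique_path /= K.
Qed.

(** There are n - 1 choices for the first vertex, at least 7n/9 for the second and n/3 for the
    third, and 7(n - 1)/27 >= n/9 for n >= 2. The other [k] entries of the sample are free. *)
Lemma vertex_density v k : 2 <= n ->
  n ^+ 3 / 9 * n ^+ k <= tsum (3 + k) (fun s => (clique_path e (v :: take 3 s))%:R).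
Proof.
move=> n2; rewrite tsum_cat.
apply: le_trans (_ : tsum 3 (fun s => (clique_path e (v :: s))%:R * n ^+ k) <= _); last first.
  apply: ler_tsum => s sz; rewrite (eq_tsum (G := fun=> (clique_path e (v :: s))%:R)).
    by rewrite tsum_const mulrC.
  by move=> s' _; rewrite take_size_cat.
rewrite (eq_tsum (G := fun s => n ^+ k * (clique_path e (v :: s))%:R)); last first.
  by move=> s _; rewrite mulrC.
rewrite tsumZ mulrC ler_wpM2l ?exprn_ge0 //.
apply: le_trans (_ : \sum_(x : V) \sum_(y : V) (e v x y)%:R * (n / 3) <= _); last first.
  rewrite /=; apply: ler_sum => x _; apply: ler_sum => y _.
  case E: (e v x y); last by rewrite mul0r sumr_ge0.
  by have := extension_density 1 E; rewrite expr1 mul1r.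
apply: le_trans (_ : \sum_(x : V) (x != v)%:R * (7 / 9 * n * (n / 3)) <= _).
  rewrite -mulr_suml.
  have -> : \sum_(x : V) (x != v)%:R = n - 1 :> R.
    have : \sum_(x : V) ((x != v)%:R + (x == v)%:R) = n :> R.
      rewrite (eq_bigr (fun=> 1)) => [|x _]; last by case: eqP; rewrite ?addr0 ?add0r.
      by rewrite sumr_const.
    rewrite big_split /= => <-.
    have -> : \sum_(x : V) (x == v)%:R = 1 :> R.
      by rewrite (bigD1 v) //= eqxx big1 ?addr0 // => i /negbTE ->.
    by rewrite addrK.
  by rewrite !exprS expr0; nra.
apply: ler_sum => x _; rewrite -mulr_suml mulrA ler_wpM2r ?divr_ge0 //.
case: eqVneq => xv /=; first by rewrite mul0r sumr_ge0.
rewrite mul1r; have := deg (x := v) (y := x); rewrite eq_sym xv => /(_ isT).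
rewrite card_natr mulrDl => h; apply: le_trans (_ : 7 / 9 * n + alpha * n <= _).
  by rewrite lerDl mulr_ge0 // ltW.
by apply: le_trans h _; apply: ler_sum => y _; rewrite inE.
Qed.

End Density.

Lemma tsum_hit (R : realType) (V : finType) (F : pred V) m :
  #|V|%:R * tsum m (fun s => (has F s)%:R) <= m%:R * #|F|%:R * #|V|%:R ^+ m :> R.
Proof.
elim: m => [|m IH]; first by rewrite /= mulr0 mul0r mul0r.
set n : R := #|V|%:R in IH *; rewrite /=.
apply: le_trans (_ : n * \sum_(x : V) tsum m (fun s => (F x)%:R + (has F s)%:R) <= _).
  rewrite ler_wpM2l //; apply: ler_sum => x _; apply: ler_tsum => s _.
  by case: (F x); case: (has F s) => /=; lra.
have -> : \sum_(x : V) tsum m (fun s => (F x)%:R + (has F s)%:R) =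
   #|F|%:R * n ^+ m + n * tsum m (fun s => (has F s)%:R).
  transitivity (\sum_(x : V) ((F x)%:R * n ^+ m + tsum m (fun s => (has F s)%:R))).
    by apply: eq_bigr => x _; rewrite tsumD tsum_const mulrC.
  rewrite big_split /= -mulr_suml sumr_const -[X in _ + X]mulr_natl; congr (_ * _ + _).
  rewrite -sum1_card natr_sum [RHS]big_mkcond; apply: eq_bigr => x _.
  by rewrite unfold_in; case: (F x).
rewrite mulrDr -[m.+1%:R]natr1; apply: le_trans (lerD (lexx _) (ler_wpM2l _ IH)) _ => //.
by rewrite exprS le_eqVlt; apply/orP; left; apply/eqP; ring.
Qed.

(** * Connecting edges *)

Lemma K4_rev (V : finType) (e : triple_system V) a b c d : K4 e a b c d = K4 e d c b a.
Proof. by rewrite [LHS]K4_flip [LHS]K4_swap 2![LHS]K4_rot. Qed.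

(** The witness may vary with the sample, but one of the finitely many serves a fixed share of the
    samples, and [box_dense] applies to that one. Dividing by |W| + 1 rather than |W| makes the
    pigeonhole strict and covers an empty [W]. *)
Lemma dense_box (R : realType) (W : finType) m t (c : R) : 0 < c ->
  exists c' : R, 0 < c' /\ exists n0 : nat,
  forall (V : finType) (Q : seq V -> bool) (P : W -> seq V -> bool),
  (n0 <= #|V|)%N -> (forall s, size s = m -> Q s -> exists w, P w s) ->
  c * #|V|%:R ^+ m <= tsum m (fun s => (Q s)%:R) ->
  exists w, c' * #|{ffun 'I_t.+1 -> V}|%:R ^+ m <=
    tsum m (fun X : seq {ffun 'I_t.+1 -> V} => (box (P w) X)%:R).
Proof.
move=> c0; pose N : R := #|W|.+1%:R.
have [c' [c'0 [n0 Hn0]]] := @box_dense R m t.+1 (c / N) ltac:(by rewrite divr_gt0 ?ltr0n).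
exists c'; split=> //; exists (maxn 1 n0) => V Q P; rewrite geq_max => /andP [V0 Vn0] QP dens.
have n_gt0 : 0 < #|V|%:R :> R by rewrite ltr0n.
have [w hw] : exists w, c / N * #|V|%:R ^+ m <= tsum m (fun s => (P w s)%:R).
  apply/existsP; apply: contraLR dens; rewrite negb_exists => /forallP h; rewrite -ltNge.
  apply: le_lt_trans (_ : \sum_(w : W) tsum m (fun s => (P w s)%:R) < _).
    rewrite -tsum_sum; apply: ler_tsum => s sz; case Qs: (Q s); last exact: sumr_ge0.
    by have [w Pw] := QP s sz Qs; rewrite (bigD1 w) //= Pw ler_wpDr // sumr_ge0.
  apply: le_lt_trans (_ : \sum_(w : W) (c / N * #|V|%:R ^+ m) < _).
    by apply: ler_sum => w _; rewrite ltW // ltNge h.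
  rewrite sumr_const -[_ *+ _]mulr_natl mulrA ltr_pM2r ?exprn_gt0 //.
  rewrite mulrCA mulrC gtr_pMl // ltr_pdivrMr ?ltr0n // mul1r ltr_nat; exact: ltnSn.
by exists w; rewrite card_ffun card_ord; apply: Hn0.
Qed.

Section SamplePath.
Variables (V : finType) (e : triple_system V) (a b c x y z : V) (s : seq V).

(** Three entries of the sample continue [a b c] and three others continue the reversed end [z y x].
    The connecting walk inside the sample runs from the first triple to the second one read
    backwards. *)
Lemma sample_path m : (6 <= m)%N -> size s = m -> good_sample e s ->
  clique_path e [:: a, b, c & take 3 s] ->
  clique_path e [:: z, y, x & take 3 (drop 3 s)] ->
  exists u : (m ^ 3 + 3).-bseq 'I_m,
    clique_path e ([:: a; b; c] ++ [seq nth a s i | i : 'I_m <- u] ++ [:: x; y; z]).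
Proof.
move=> m6 sz good h1 h2.
have dn : codense (sample e a s m) by rewrite -sz; apply: sample_codense.
have lt k : (k < 6)%N -> (k < m)%N by move/leq_trans; apply.
pose o k (h : (k < 6)%N) := Ordinal (lt k h).
pose i0 := o 0%N isT; pose i1 := o 1%N isT; pose i2 := o 2%N isT.
pose i3 := o 3%N isT; pose i4 := o 4%N isT; pose i5 := o 5%N isT.
have s6 : (6 <= size s)%N by rewrite sz.
have t1 : take 3 s = [:: nth a s i0; nth a s i1; nth a s i2].
  by case: (s) s6 => [|? [|? [|? ?]]] //= _; rewrite take0.
have t2 : take 3 (drop 3 s) = [:: nth a s i3; nth a s i4; nth a s i5].
  by case: (s) s6 => [|? [|? [|? [|? [|? [|? ?]]]]]] //= _; rewrite take0.
rewrite {}t1 in h1; rewrite {}t2 in h2.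
have e1 : sample e a s m i0 i1 i2.
  by move: h1; rewrite /clique_path /= => /and4P [_ _ /and4P [_ _ _ ?] _].
have e2 : sample e a s m i5 i4 i3.
  move: h2; rewrite /clique_path /= => /and4P [_ _ /and4P [_ _ _ E] _].
  by change (e (nth a s i5) (nth a s i4) (nth a s i3)); edge_sym.
have [u sz_u [cp [u1 uE1] [u2 uE2]]] := sample_word dn e1 e2.
exists (Bseq sz_u) => /=.
rewrite {1}uE1 /= -[X in clique_path e X]/([:: a; b; c] ++ [:: nth a s i0, nth a s i1, nth a s i2 & _]).
rewrite /clique_path win4_cat; apply/andP; split; first exact: h1.
rewrite -[X in win4 _ X]/([seq nth a s i | i : 'I_m <- [:: i0; i1; i2] ++ u1] ++ [:: x; y; z]) -uE1 uE2.
rewrite map_cat -catA win4_cat; apply/andP; split; first by move: cp; rewrite uE2 map_cat.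
rewrite -(win4_rev _ (@K4_rev _ e)); exact: h2.
Qed.

End SamplePath.

Lemma connecting (R : realType) (alpha : R) : 0 < alpha ->
  exists gamma : R, 0 < gamma /\ exists l n0 : nat, 
  forall (V : finType) (e : triple_system V), (n0 <= #|V|)%N ->
  (forall x y, x != y -> (7 / 9 + alpha) * #|V|%:R <= #|nbr e x y|%:R) ->
  forall F : {set V}, #|F|%:R <= gamma * #|V|%:R ->
  forall a b c x y z, e a b c -> e x y z ->
  exists C, [/\ (size C <= l)%N, uniq C, all (fun v => v \notin F) C &
                clique_path e ([:: a; b; c] ++ C ++ [:: x; y; z])].
Proof.
(* Six extension vertices, each with at least n/3 choices. A quarter of [k0] is lost to bad samples
   and a quarter to samples meeting [F], so [k0 / 2] remains. *)
move=> a0; pose k0 : R := (1 / 3) ^+ 6.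
have k0_gt0 : 0 < k0 by rewrite exprn_gt0 ?divr_gt0.
have [m [m6 [n1 Hn1]]] := sampling a0 (ltac:(by rewrite divr_gt0) : 0 < k0 / 4).
have m_gt0 : 0 < m%:R :> R by rewrite ltr0n (leq_trans _ m6).
pose L := (m ^ 3 + 3)%N.
have [c' [c'0 [n2 Hn2]]] := @dense_box R (L.-bseq 'I_m) m L (k0 / 2) ltac:(by rewrite divr_gt0).
exists (k0 / 4 / m%:R); split; first by rewrite !divr_gt0.
exists L, (maxn 1 (maxn n1 n2)) => V e; rewrite !geq_max => /and3P [V0 Vn1 Vn2] deg F Fsmall.
move=> a b c x y z e1 e2; pose n : R := #|V|%:R.
have n_gt0 : 0 < n by rewrite ltr0n.
pose T (s : seq V) := clique_path e [:: a, b, c & take 3 s] &&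
                      clique_path e [:: z, y, x & take 3 (drop 3 s)].
pose Q s := [&& T s, good_sample e s & ~~ has (mem F) s].
pose P (u : L.-bseq 'I_m) s := [&& uniq s, all (fun v => v \notin F) s &
  clique_path e ([:: a; b; c] ++ [seq nth a s i | i : 'I_m <- u] ++ [:: x; y; z])].
have [s sz /and3P [/andP [T1 T2] good nF]||u hX] := Hn2 V Q P Vn2.
- have [u cu] := sample_path m6 sz good T1 T2; exists u; apply/and3P; split=> //.
    by case/andP: good.
  by rewrite -all_predC in nF.
- have densT : k0 * n ^+ m <= tsum m (fun s => (T s)%:R).
    have e2' : e z y x by edge_sym.
    have [k mE] : exists k, m = (3 + (3 + k))%N by exists (m - 6)%N; rewrite addnA subnKC.
    have := extension_density a0 deg 3 e1; have := extension_density a0 deg 3 e2'.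
    set d2 := tsum 3 _; set d1 := tsum 3 _ => h2 h1.
    have -> : tsum m (fun s => (T s)%:R) = d1 * (d2 * n ^+ k).
      rewrite mE tsum_cat.
      transitivity (tsum 3 (fun s1 => d2 * n ^+ k * (clique_path e [:: a, b, c & s1])%:R));
        last by rewrite tsumZ mulrC.
      apply: eq_tsum => s1 sz1; rewrite tsum_cat.
      transitivity (tsum 3 (fun s2 => (n ^+ k * (clique_path e [:: a, b, c & s1])%:R) *
        (clique_path e [:: z, y, x & s2])%:R)); last by rewrite tsumZ -/d2; ring.
      apply: eq_tsum => s2 sz2.
      rewrite (eq_tsum (G := fun=> (clique_path e [:: a, b, c & s1])%:R *
                 (clique_path e [:: z, y, x & s2])%:R)) ?tsum_const -/n ?mulrA //.
      move=> s3 _; rewrite /T take_size_cat // drop_size_cat // take_size_cat //.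
      by case: (clique_path e _) => /=; rewrite ?mul1r ?mul0r.
    have -> : k0 * n ^+ m = (n / 3) ^+ 3 * ((n / 3) ^+ 3 * n ^+ k).
      rewrite mE 2!exprD /k0 -[(1 / 3) ^+ 6]/((1 / 3) ^+ (3 + 3)) exprD !exprMn.
      by move: (n ^+ k) => N; rewrite expr1n; ring.
    have n30 : 0 <= (n / 3) ^+ 3 by rewrite exprn_ge0 // divr_ge0 // ltW.
    have nk0 : 0 <= n ^+ k by rewrite exprn_ge0 // ltW.
    apply: ler_pM => //; first by rewrite mulr_ge0.
    exact: ler_wpM2r.
  have hit : tsum m (fun s : seq V => (has (mem F) s)%:R) <= k0 / 4 * n ^+ m.
    have := tsum_hit R (mem F) m; rewrite -/n => h.
    rewrite -(ler_pM2l n_gt0); apply: le_trans h _; rewrite mulrA ler_wpM2r ?exprn_ge0 //.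
    rewrite mulrC -ler_pdivlMr //; apply: le_trans Fsmall _.
    by rewrite -/n le_eqVlt; apply/orP; left; apply/eqP; ring.
  have := Hn1 V e Vn1 deg; rewrite -/n => bad.
  have : tsum m (fun s => (T s)%:R) <= tsum m (fun s => (Q s)%:R) +
     (tsum m (fun s => (~~ good_sample e s)%:R) + tsum m (fun s => (has (mem F) s)%:R)) :> R.
    rewrite -!tsumD; apply: ler_tsum => s _; rewrite /Q.
    rewrite -!natrD ler_nat.
    by case: (T s); case: (good_sample e s); case: (has _ s).
  by move: densT hit bad; move: (n ^+ m) (tsum _ _) (tsum _ _) (tsum _ _) (tsum _ _) => *; lra.
have /tsum_gt0 [X szX boxX] : 0 < tsum m (fun X : seq {ffun 'I_L.+1 -> V} => (box (P u) X)%:R : R).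
  apply: lt_le_trans hX; rewrite mulr_gt0 ?exprn_gt0 // ltr0n card_ffun card_ord.
  by rewrite expn_gt0 V0.
have {}boxX : box (P u) X by move: boxX; case: (box _ _) => //; rewrite ltxx.
pose xs (i : nat) (c : 'I_L.+1) : V := nth [ffun=> a] X i c.
(* Position [p] of the word uses copy [p] of its sample vertex, so repeated visits yield distinct
   vertices. *)
pose W : seq (V + nat * 'I_L.+1) :=
  [seq inr (val (nth (Ordinal (leq_trans (isT : (0 < 6)%N) m6)) u p), inord p) | p <- iota 0 (size u)].
have szu : (size u <= L)%N by apply: size_bseq.
have WP l : l \in W -> exists i d, l = inr (i, d) /\ (i < size X)%N.
  by case/mapP=> p _ ->; eexists; eexists; split; [reflexivity | rewrite szX /=].
have Pu s : P u s -> uniq s by case/and3P.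
have PF s : P u s -> all (fun v => v \notin F) s by case/and3P.
exists (map (xval xs) W); split.
- by rewrite !size_map size_iota.
- rewrite map_inj_in_uniq.
    rewrite map_inj_in_uniq ?iota_uniq // => p q; rewrite !mem_iota /= !add0n => pu qu [_].
    by move/(f_equal val); rewrite /= !inordK // ltnS; apply: leq_trans szu; apply: ltnW.
  move=> l l' /WP [i [d [-> li]]] /WP [j [d' [-> lj]]] /= E.
  by have [-> ->] := box_injective boxX Pu li lj E.
- apply/allP => _ /mapP [l /WP [i [d [-> li]]] ->] /=.
  exact: (@box_entry _ _ _ _ a boxX (fun v => v \notin F) PF).
have := @clique_path_lift V e L xs ([:: inl a; inl b; inl c] ++ W ++ [:: inl x; inl y; inl z]).
rewrite !map_cat /=; apply=> ch; rewrite !map_cat.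
have /and3P [_ _] := box_sample a boxX ch; rewrite szX.
set s := mkseq _ _; suff -> : [seq sval (fun i => xs i (ch i)) i | i <- W] =
    [seq nth a s i | i : 'I_m <- u] by [].
rewrite -map_comp; apply: (@eq_from_nth _ a); rewrite !size_map ?size_iota // => p pu.
rewrite (nth_map (Ordinal (leq_trans (isT : (0 < 6)%N) m6))) // (nth_map 0%N) ?size_iota //=.
by rewrite nth_iota // nth_mkseq.
Qed.

(** * Absorbers *)

Definition rearranges (V : finType) (e : triple_system V) P X P' :=
  [/\ clique_path e P', perm_eq P' (X ++ P), take 3 P' = take 3 P &
      drop (size P' - 3) P' = drop (size P - 3) P].

Definition absorbs (V : finType) (e : triple_system V) A v :=
  exists A', rearranges e A [:: v] A'.

Arguments gadget_words : simpl never.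
Arguments numbered : simpl never.

Section GadgetLetters.
Variables (V : finType) (e : triple_system V) (m : nat).
Notation letter := (V + nat * 'I_256)%type.

Definition gadget_letter (h : 'I_7 -> 'I_m) v (lc : nat * nat) : letter :=
  if (lc.1 < 7)%N then inr (h (inord lc.1) : nat, inord lc.2) else inl v.

Definition gadget_label (h : 'I_7 -> 'I_m) v (s : seq V) l : V :=
  if (l < 7)%N then nth v s (h (inord l)) else v.

Lemma gadget_letter_label h v s w :
  [seq sval (nth v s) l | l <- map (gadget_letter h v) (numbered w)] =
  map (gadget_label h v s) w.
Proof.
rewrite -[in RHS](numberedK w); elim: (numbered w) => [|[l c] u IH] //=.
by rewrite -IH /gadget_letter /gadget_label /=; case: ifP.
Qed.

(** The gadget is built inside the sample on the edge formed by its first three entries; only label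
    7 stands for [v] itself. A type [w] records the places of the labels and the index [j], so the
    number of types depends on [m] alone. *)
Lemma sample_gadget v s : (3 <= m)%N -> size s = m -> good_sample e s ->
  clique_path e (v :: take 3 s) -> exists w : {ffun 'I_7 -> 'I_m} * 'I_4,
    clique_path e (map (gadget_label w.1 v s) (gadget_words w.2).1) /\
    clique_path e (map (gadget_label w.1 v s) (gadget_words w.2).2).
Proof.
move=> m3 sz good cp.
have dn : codense (sample e v s m) by rewrite -sz; apply: sample_codense.
have lt k : (k < 3)%N -> (k < m)%N by move/leq_trans; apply.
pose i0 := Ordinal (lt 0%N isT); pose i1 := Ordinal (lt 1%N isT).
pose i2 := Ordinal (lt 2%N isT).
have s3 : (3 <= size s)%N by rewrite sz.
have t1 : take 3 s = [:: nth v s i0; nth v s i1; nth v s i2].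
  by case: (s) s3 => [|? [|? [|? ?]]] //= _; rewrite take0.
rewrite {}t1 in cp.
have Kv : K4 e v (nth v s i0) (nth v s i1) (nth v s i2).
  by move: cp; rewrite /clique_path /= => /andP [].
have e1 : sample e v s m i0 i1 i2 by case/and4P: Kv.
have [j [h [j4 [c1 c2 c3 c4] pm]]] := edge_gadget dn e1.
pose hf := [ffun l : 'I_7 => h l]; exists (hf, Ordinal j4).
rewrite [(hf, _).1]/= [(hf, _).2]/= [nat_of_ord _]/=.
pose lab := gadget_label hf v s.
have labE l : (l < 7)%N -> lab l = nth v s (h l).
  by move=> l7; rewrite /lab /gadget_label l7 ffunE inordK.
apply: (@gadget_path _ e lab j j4); first by split; rewrite !labE.
have oth k : (k < 3)%N -> (others j k < 7)%N.
  by move: k; case: j j4 {c1 c2 c3 c4 pm} => [|[|[|[|]]]] // _ [|[|[|]]].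
rewrite [lab 7]/lab /gadget_label /= !labE ?oth //.
pose f (o : option 'I_m) := if o is Some i then nth v s i else v.
have un : uniq [:: i0; i1; i2] by [].
have E : [seq h i | i <- rem j (iota 0 4)] = [:: h (others j 0); h (others j 1); h (others j 2)].
  by case: j j4 {c1 c2 c3 c4 pm oth} => [|[|[|[|]]]].
rewrite {}E in pm.
have un2 : uniq (None :: map Some [:: h (others j 0); h (others j 1); h (others j 2)]).
  by rewrite cons_uniq map_inj_uniq ?(perm_uniq pm) // => x y [].
apply: (@K4_sub _ e _ f None (Some i0) (Some i1) (Some i2) None _ _ _ Kv un2).
apply/allP => o; rewrite in_cons => /predU1P [->|oin]; first by rewrite !inE.
have /mapP [i iin ->] : o \in map Some [:: h (others j 0); h (others j 1); h (others j 2)].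
  exact: oin.
rewrite (perm_mem pm) in iin.
have : Some i \in map Some [:: i0; i1; i2] by rewrite mem_map // => x y [].
by rewrite /= !inE => ->.
Qed.

End GadgetLetters.

Section BoxedGadget.
Variables (V : finType) (e : triple_system V) (m : nat).

Definition boxed_gadget (F : {set V}) v (w : {ffun 'I_7 -> 'I_m} * 'I_4) (s : seq V) :=
  [&& uniq s, all (fun x => x \notin v |: F) s,
      clique_path e (map (gadget_label w.1 v s) (gadget_words w.2).1) &
      clique_path e (map (gadget_label w.1 v s) (gadget_words w.2).2)].

Variables (a : V) (w : {ffun 'I_7 -> 'I_m} * 'I_4) (F : {set V}).
Variable X : seq {ffun 'I_256 -> V}.
Hypothesis szX : size X = m.
Let xs (i : nat) (c : 'I_256) : V := nth [ffun=> a] X i c.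

Definition gadget_vertices v u : seq V :=
  [seq xval xs l | l <- map (gadget_letter w.1 v) (numbered u)].

Lemma boxed_gadget_path v u : (forall s, boxed_gadget F v w s ->
    clique_path e (map (gadget_label w.1 v s) u)) ->
  box (boxed_gadget F v w) X -> clique_path e (gadget_vertices v u).
Proof.
move=> Pu boxX; apply: clique_path_lift => ch.
have := Pu _ (box_sample a boxX ch); rewrite -gadget_letter_label szX.
rewrite -2!map_comp; congr (is_true (clique_path e _)); apply: eq_map => -[l c] /=.
rewrite /gadget_letter; case: ifP => //= _.
by rewrite nth_mkseq.
Qed.

(** The second word does not contain label 7, so the path [A] does not depend on the vertex to be
    absorbed: one box yields one absorber for all [v] that it suits. *)
Lemma boxed_gadget_absorbs v0 v : box (boxed_gadget F v0 w) X -> box (boxed_gadget F v w) X ->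
  let A := gadget_vertices v0 (gadget_words w.2).2 in
  [/\ size A = 31%N, uniq A, all (fun x => x \notin v |: F) A, clique_path e A & absorbs e A v].
Proof.
move=> box0 boxX A.
have [pm tk dr /allP small /andP [un /eqP szB]] := gadget_words_ok (ltn_ord w.2).
have AE : A = gadget_vertices v (gadget_words w.2).2.
  rewrite /A /gadget_vertices -2!map_comp; apply/eq_in_map => lc /small /andP [l7 _] /=.
  by rewrite /gadget_letter l7.
have AE2 : A = [seq xs (w.1 (inord lc.1)) (inord lc.2) | lc <- numbered (gadget_words w.2).2].
  rewrite /A /gadget_vertices -map_comp; apply/eq_in_map => lc /small /andP [l7 _] /=.
  by rewrite /gadget_letter l7.
have lt i : (w.1 i < size X)%N by rewrite szX.
split.
- by rewrite /A !size_map.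
- rewrite AE2; move: small un; move: (numbered (gadget_words w.2).2) => u small.
  rewrite !uniq_pairwise !pairwise_map; apply: (sub_in_pairwise (P := mem u)); last exact/allP.
  move=> lc lc' /small /andP [_ l1] /small /andP [_ l2] /=; apply: contraNneq => E.
  have [_ /(f_equal (@nat_of_ord 256))] := box_injective boxX
    (fun s (h : boxed_gadget F v w s) => proj1 (andP h)) (lt _) (lt _) E.
  by rewrite (inordK l1) (inordK l2) => ->.
- rewrite AE2; apply/allP => _ /mapP [lc _ ->].
  apply: (box_entry a boxX (Q := fun x => x \notin v |: F)); last exact: lt.
  by move=> s /and4P [].
- by rewrite AE; apply: boxed_gadget_path boxX => s /and4P [].
exists (gadget_vertices v (gadget_words w.2).1); split.
- by apply: boxed_gadget_path boxX => s /and4P [].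
- by rewrite AE; apply: (perm_map _ (perm_map (gadget_letter w.1 v) pm)).
- by rewrite AE /gadget_vertices -2!map_take tk 2!map_take.
by rewrite AE /gadget_vertices -2!map_drop !size_map dr 2!map_drop.
Qed.

End BoxedGadget.

Lemma absorbers (R : realType) (alpha : R) : 0 < alpha ->
  exists c gamma : R, [/\ 0 < c, c <= 1 / 2, 0 < gamma & exists n0 : nat,
  forall (V : finType) (e : triple_system V), (n0 <= #|V|)%N ->
  (forall x y, x != y -> (7 / 9 + alpha) * #|V|%:R <= #|nbr e x y|%:R) ->
  forall F : {set V}, #|F|%:R <= gamma * #|V|%:R ->
  forall g : V -> R, (forall v, 0 <= g v) -> 0 < \sum_v g v ->
  exists (A : seq V) (S : {set V}),
    [/\ size A = 31%N, uniq A, all (fun x => x \notin F) A & clique_path e A] /\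
    [/\ forall v, v \in S -> v \notin A, forall v, v \in S -> absorbs e A v &
        c * \sum_v g v <= \sum_(v in S) g v]].
Proof.
move=> a0; pose k0 : R := 1 / 9; have k0_gt0 : 0 < k0 by rewrite divr_gt0.
have [m [m6 [n1 Hn1]]] := sampling a0 (ltac:(by rewrite divr_gt0) : 0 < k0 / 4).
have m_gt0 : 0 < m%:R :> R by rewrite ltr0n (leq_trans _ m6).
pose W := ({ffun 'I_7 -> 'I_m} * 'I_4)%type.
have [c' [c'0 [n2 Hn2]]] := @dense_box R W m 255 (k0 / 2) ltac:(by rewrite divr_gt0).
have [n3 Hn3] := eventually_ge (m%:R * 8 / k0).
pose N : R := #|{: W}|.+1%:R; have N_gt0 : 0 < N by rewrite ltr0n.
exists (Num.min (c' / N) (1 / 2)), (k0 / 8 / m%:R); split.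
- by rewrite lt_min !divr_gt0.
- by rewrite ge_min lexx orbT.
- by rewrite !divr_gt0.
exists (maxn 2 (maxn n1 (maxn n2 n3))) => V e; rewrite !geq_max.
move=> /and4P [V2 Vn1 Vn2 Vn3] deg F Fsmall g g0 gpos.
pose n : R := #|V|%:R.
have V0 : (0 < #|V|)%N by apply: leq_trans V2.
have n_gt0 : 0 < n by rewrite ltr0n.
have [a _] : exists a : V, a \in V by apply/card_gt0P.
pose M : R := #|{ffun 'I_256 -> V}|%:R ^+ m.
have dens v : exists w : W, c' * M <= tsum m (fun X : seq {ffun 'I_256 -> V} =>
    (box (boxed_gadget e F v w) X)%:R).
  pose Q s := [&& clique_path e (v :: take 3 s), good_sample e s & ~~ has (mem (v |: F)) s].
  apply: (Hn2 V Q _ Vn2).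
    move=> s sz /and3P [cp good nF].
    have [w [w1 w2]] := sample_gadget (leq_trans (isT : (3 <= 6)%N) m6) sz good cp.
    exists w; apply/and4P; split=> //; first by case/andP: good.
    by rewrite -all_predC in nF.
  have densT : k0 * n ^+ m <= tsum m (fun s => (clique_path e (v :: take 3 s))%:R).
    have [k mE] : exists k, m = (3 + k)%N by exists (m - 3)%N; rewrite subnKC // (leq_trans _ m6).
    have := vertex_density a0 deg v k; rewrite -mE ler_nat => /(_ V2).
    by apply: le_trans; rewrite mE exprD /k0 le_eqVlt; apply/orP; left; apply/eqP; ring.
  have hit : tsum m (fun s : seq V => (has (mem (v |: F)) s)%:R) <= k0 / 4 * n ^+ m.
    have := tsum_hit R (mem (v |: F)) m; rewrite -/n => h.
    rewrite -(ler_pM2l n_gt0); apply: le_trans h _; rewrite mulrA ler_wpM2r ?exprn_ge0 //.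
    have le : #|v |: F|%:R <= 1 + k0 / 8 / m%:R * n.
      apply: le_trans (lerD (lexx 1) Fsmall); rewrite -[1]/(1%:R) -natrD ler_nat.
      by rewrite cardsU1 leq_add2r leq_b1.
    have n8 : m%:R <= k0 / 8 * n.
      by move: (Hn3 _ Vn3); rewrite -/n ler_pdivrMr //; clear; lra.
    apply: le_trans (ler_wpM2l (ltW m_gt0) le) _; rewrite mulrDr mulr1.
    have -> : m%:R * (k0 / 8 / m%:R * n) = k0 / 8 * n.
      by rewrite mulrA; congr (_ * _); rewrite mulrC divfK // gt_eqF.
    by rewrite [n * _]mulrC; move: n8; clear; lra.
  have := Hn1 V e Vn1 deg; rewrite -/n => bad.
  have : tsum m (fun s => (clique_path e (v :: take 3 s))%:R) <= tsum m (fun s => (Q s)%:R) +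
     (tsum m (fun s => (~~ good_sample e s)%:R) + tsum m (fun s => (has (mem (v |: F)) s)%:R)) :> R.
    rewrite -!tsumD; apply: ler_tsum => s _; rewrite /Q -!natrD ler_nat.
    by case: (clique_path e _); case: (good_sample e s); case: (has _ s).
  rewrite -/n; move: densT hit bad.
  by move: (n ^+ m) (tsum _ _) (tsum _ _) (tsum _ _) (tsum _ _); clear => *; lra.
pose D (w : W) v : R :=
  tsum m (fun X : seq {ffun 'I_256 -> V} => (box (boxed_gadget e F v w) X)%:R).
have D0 w v : 0 <= D w v by apply: tsum_ge0.
have M_gt0 : 0 < M by rewrite exprn_gt0 // ltr0n card_ffun card_ord expn_gt0 V0.
(* Pigeonhole over the types, weighted by [g]. Averaging over boxes of the chosen type then gives a
   single box suiting a fixed share of the weight. *)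
have [w Hw] : exists w : W, c' / N * (\sum_v g v) * M <= \sum_v g v * D w v.
  apply/existsP; apply/contraT; rewrite negb_exists => /forallP h.
  have : \sum_v g v * (c' * M) <= \sum_v \sum_(w : W) g v * D w v.
    apply: ler_sum => v _; rewrite -mulr_sumr ler_wpM2l //; have [w hw] := dens v.
    by apply: le_trans hw _; rewrite (bigD1 w) //= lerDl sumr_ge0.
  rewrite exchange_big leNgt => /negP []; rewrite -mulr_suml.
  apply: le_lt_trans (_ : \sum_(w : W) (c' / N * (\sum_v g v) * M) < _).
    by apply: ler_sum => w _; rewrite ltW // ltNge h.
  rewrite sumr_const -[_ *+ _]mulr_natl.
  have -> : c' / N * (\sum_v g v) * M = N^-1 * ((\sum_v g v) * (c' * M)) by ring.
  rewrite [ltLHS]mulrA gtr_pMl ?mulr_gt0 // ltr_pdivrMr // mul1r ltr_nat; exact: ltnSn.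
have [X szX HX] : exists2 X : seq {ffun 'I_256 -> V}, size X = m & c' / N * \sum_v g v <=
    \sum_v g v * (box (boxed_gadget e F v w) X)%:R.
  apply: (@tsum_avg _ _ m (fun X => \sum_v g v * (box (boxed_gadget e F v w) X)%:R)).
    by rewrite card_ffun card_ord expn_gt0 V0.
  rewrite tsum_sum; apply: le_trans Hw _; rewrite le_eqVlt; apply/orP; left; apply/eqP.
  by apply: eq_bigr => v _; rewrite tsumZ.
pose S := [set v | box (boxed_gadget e F v w) X].
have SE : \sum_(v in S) g v = \sum_v g v * (box (boxed_gadget e F v w) X)%:R.
  rewrite big_mkcond; apply: eq_bigr => v _; rewrite inE.
  by case: (box _ _); rewrite ?mulr1 ?mulr0.
have [v0 v0S] : exists v0, v0 \in S.
  apply/set0Pn; apply/eqP => S0; move: HX; rewrite -SE S0 big_set0 leNgt mulr_gt0 //.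
  exact: divr_gt0.
have gad v : v \in S -> let A := gadget_vertices a w X v0 (gadget_words w.2).2 in
  [/\ size A = 31%N, uniq A, all (fun x => x \notin v |: F) A, clique_path e A & absorbs e A v].
  by rewrite !inE in v0S * => vS; apply: (boxed_gadget_absorbs a szX v0S vS).
exists (gadget_vertices a w X v0 (gadget_words w.2).2), S; split.
  have [szA uA /allP AF cpA _] := gad _ v0S; split=> //; apply/allP => x /AF.
  by rewrite inE negb_or => /andP [].
split.
- move=> v /gad [_ _ /allP h _ _]; apply/negP => /h; by rewrite setU11.
- by move=> v /gad [].
rewrite SE; apply: le_trans HX; apply: ler_wpM2r; first exact: ltW.
by rewrite ge_min lexx.
Qed.

(** * Greedy assembly *)

(** [os] tells each absorber which vertex to take, [None] for an idle one. *)
Definition fits (V : finType) (os : seq (option V)) (Ss : seq {set V}) :=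
  all2 (fun o (S : {set V}) => if o is Some v then v \in S else true) os Ss.

Lemma clique_path_glue (V : finType) (e : triple_system V) s1 x y z C p q r s2 :
  clique_path e (s1 ++ [:: x; y; z]) -> clique_path e ([:: x; y; z] ++ C ++ [:: p; q; r]) ->
  clique_path e [:: p, q, r & s2] ->
  clique_path e ((s1 ++ [:: x; y; z]) ++ C ++ [:: p, q, r & s2]).
Proof.
move=> h1 h2 h3; rewrite -catA /clique_path win4_cat; apply/andP; split; first exact: h1.
by have := win4_cat (K4 e) ([:: x; y; z] ++ C) p q r s2 => /= ->; apply/andP.
Qed.

Lemma take3P (T : Type) (s : seq T) : (3 <= size s)%N ->
  exists x y z t, s = [:: x, y, z & t].
Proof. by case: s => [|x [|y [|z t]]] // _; exists x, y, z, t. Qed.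

Lemma drop3P (T : Type) (s : seq T) : (3 <= size s)%N ->
  exists t x y z, s = t ++ [:: x; y; z].
Proof.
move=> s3; have : size (drop (size s - 3) s) = 3 by rewrite size_drop subKn.
case E: (drop _ s) => [|x [|y [|z [|? ?]]]] // _.
by exists (take (size s - 3) s), x, y, z; rewrite -E cat_take_drop.
Qed.

Lemma clique_path_edge (V : finType) (e : triple_system V) s1 x y z s2 :
  (4 <= size (s1 ++ [:: x, y, z & s2]))%N -> clique_path e (s1 ++ [:: x, y, z & s2]) -> e x y z.
Proof.
case/lastP: s1 => [|s1 w] s4 /win4P h.
  case: s2 s4 h => [//|w s2] _ /(_ [::] x y z w s2 erefl); by case/and4P.
have := h s1 w x y z s2; rewrite -cats1 -catA => /(_ erefl).
by case/and4P.
Qed.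

Section Chain.
Variables (V : finType) (e : triple_system V).

Definition absorbing P Ss := forall os, fits os Ss ->
  exists P', rearranges e P (pmap id os) P'.

(** Absorbing leaves the end triples of [A] and [P] unchanged, and the connection [C] only sees
    those; hence the two pieces absorb independently. *)
Lemma absorbing_extend P Ss A (S : {set V}) C s1 x y z p q r s2 :
  P = [:: p, q, r & s2] -> A = s1 ++ [:: x; y; z] -> (3 <= size A)%N ->
  clique_path e A ->
  clique_path e ([:: x; y; z] ++ C ++ [:: p; q; r]) ->
  (forall v, v \in S -> absorbs e A v) ->
  absorbing P Ss -> absorbing (A ++ C ++ P) (S :: Ss).
Proof.
move=> PE AE A3 cA cC absA absP [//|o os] /= /andP [oS /absP [P' [cP' pmP tP dP]]].
have [A' [cA' pmA tA dA]] : exists A', rearranges e A (pmap id [:: o]) A'.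
  by case: o oS => [v /absA|_] //; exists A.
have szA' : (3 <= size A')%N by rewrite (perm_size pmA) size_cat (leq_trans A3) ?leq_addl.
have szP : (3 <= size P)%N by rewrite PE.
have szP' : (3 <= size P')%N by rewrite (perm_size pmP) size_cat (leq_trans szP) ?leq_addl.
exists (A' ++ C ++ P'); split.
- have [s1' [x' [y' [z' AE']]]] := drop3P szA'.
  have [p' [q' [r' [s2' PE']]]] := take3P szP'.
  move: dA tP; rewrite AE' AE PE PE' !size_cat !addnK !drop_size_cat //= !take0.
  move=> [? ? ?] [? ? ?]; subst x' y' z' p' q' r'.
  by rewrite AE' in cA'; rewrite PE' in cP'; apply: clique_path_glue.
- suff : perm_eq (A' ++ C ++ P') ((pmap id [:: o] ++ pmap id os) ++ A ++ C ++ P) by case: (o).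
  apply/permP => f; have /permP /(_ f) := pmA; have /permP /(_ f) := pmP.
  by rewrite !count_cat => -> ->; lia.
- by rewrite !takel_cat.
rewrite !catA [in LHS]size_cat [in RHS]size_cat -!addnBA // !drop_cat.
by rewrite !ltnNge !leq_addr /= !addKn.
Qed.

End Chain.

(** Greedy choice along [Ss]: if the current set meets [L], it takes one such vertex, which lowers
    |L| by one and every remaining count by at most one. Otherwise no count changes for the vertices
    of [L]. *)
Lemma fits_exists (V : finType) (L : seq V) (Ss : seq {set V}) :
  (forall v, v \in L -> (size L <= count (fun S : {set V} => v \in S) Ss)%N) ->
  exists os, fits os Ss /\ perm_eq (pmap id os) L.
Proof.
elim: Ss L => [|S Ss IH] L h.
  by case: L h => [|v L] h; [exists [::] | have := h v (mem_head _ _)].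
have [/hasP [v vL vS]|/hasPn none] := boolP (has (mem S) L).
  have [u|os [f pm]] := IH (rem v L).
    move=> uin; have := h u (mem_rem uin); rewrite size_rem // [count _ _]/=.
    by move=> le; rewrite -subn1 leq_subLR (leq_trans le) // leq_add2r leq_b1.
  exists (Some v :: os); split; first by rewrite /fits /= [v \in S]vS.
  by rewrite /= perm_sym (permPl (perm_to_rem vL)) perm_cons perm_sym.
have [u uL|os [f pm]] := IH L; last by exists (None :: os).
by have := h u uL; rewrite /= [u \in S](negbTE (none u uL)).
Qed.

Lemma chain (R : realType) (alpha : R) : 0 < alpha ->
  exists c gamma : R, [/\ 0 < c, c <= 1 / 2, 0 < gamma & exists D n0 : nat,
  forall (V : finType) (e : triple_system V), (n0 <= #|V|)%N ->
  (forall x y, x != y -> (7 / 9 + alpha) * #|V|%:R <= #|nbr e x y|%:R) ->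
  forall N, (N * D + 34)%:R <= gamma * #|V|%:R -> exists (P : seq V) (Ss : seq {set V}),
    [/\ (3 <= size P <= N * D + 3)%N, uniq P, clique_path e P, absorbing e P Ss &
        size Ss = N /\
        \sum_v (1 / 2) ^+ count (fun S : {set V} => v \in S) Ss <= (1 - c / 2) ^+ N * #|V|%:R]].
Proof.
move=> a0; have [c [g1 [c0 c1 g10 [n1 Habs]]]] := absorbers a0.
have [g2 [g20 [l [n2 Hcon]]]] := connecting a0.
exists c, (Num.min g1 g2); split=> //; first by rewrite lt_min g10.
(* Each round adds an absorber of 31 vertices and a connection of at most [l]. The 34 in the size
   bound counts the initial edge and the absorber that a connection must avoid besides earlier
   rounds. *)
exists (31 + l)%N, (maxn 2 (maxn n1 n2)) => V e; rewrite !geq_max => /and3P [V2 Vn1 Vn2] deg.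
set D := (31 + l)%N; have {Habs} Habs := Habs V e Vn1 deg; have {Hcon} Hcon := Hcon V e Vn2 deg.
pose n : R := #|V|%:R.
have n_gt0 : 0 < n by rewrite ltr0n (leq_trans _ V2).
pose hits v := count (fun S : {set V} => v \in S).
(* The induction also carries an edge at the start of [P], to which the next absorber is connected.
   [clique_path] does not supply it for the initial path of three vertices, which has no window. *)
suff main : forall N, (N * D + 34)%:R <= Num.min g1 g2 * n -> exists (P : seq V) (Ss : seq {set V}),
    [/\ (size P <= N * D + 3)%N, uniq P, clique_path e P, absorbing e P Ss &
        [/\ exists x y z t, P = [:: x, y, z & t] /\ e x y z, size Ss = N &
        \sum_v (1 / 2) ^+ hits v Ss <= (1 - c / 2) ^+ N * n]].
  move=> N /main [P [Ss [szP uP cP aP [[x [y [z [t [PE _]]]]] szS sum]]]].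
  by exists P, Ss; split=> //; apply/andP; split=> //; rewrite PE.
elim=> [|N IH] small.
  have [x [y [_ _ xy]]] : exists x y : V, [/\ x \in V, y \in V & x != y] by have /card_gt1P := V2.
  have [z] : exists z, z \in nbr e x y.
    apply/set0Pn; rewrite -card_gt0 -(ltr_nat R); apply: lt_le_trans (deg _ _ xy).
    by rewrite mulr_gt0 // addr_gt0 ?divr_gt0.
  rewrite inE => exyz; have [_ xz yz] := tri_neq exyz.
  exists [:: x; y; z], [::]; split=> //.
  - by rewrite /= !inE negb_or xy xz yz.
  - case=> [|//] _; exists [:: x; y; z]; split=> //.
  split=> //; first by exists x, y, z, [::].
  rewrite (eq_bigr (fun=> 1)) => [|v _]; last by rewrite expr0.
  by rewrite sumr_const mul1r.
have [P [Ss [szP uP cP aP [[p [q [r [s2 [PE epqr]]]]] szS sum]]]] :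
  exists (P : seq V) (Ss : seq {set V}),
    [/\ (size P <= N * D + 3)%N, uniq P, clique_path e P, absorbing e P Ss &
        [/\ exists x y z t, P = [:: x, y, z & t] /\ e x y z, size Ss = N &
        \sum_v (1 / 2) ^+ hits v Ss <= (1 - c / 2) ^+ N * n]].
  by apply: IH; apply: le_trans small; rewrite ler_nat leq_add2r leq_mul2r leqnSn orbT.
have le k : (k <= N.+1 * D + 34)%N -> k%:R <= g1 * n /\ k%:R <= g2 * n.
  rewrite -(ler_nat R) => /le_trans /(_ small) h.
  split; apply: le_trans h _; rewrite ler_wpM2r ?(ltW n_gt0) // ge_min lexx ?orbT //.
(* A new absorber halves the weight of the vertices it serves. *)
pose g v : R := (1 / 2) ^+ hits v Ss.
have g_gt0 v : 0 < g v by rewrite exprn_gt0 ?divr_gt0.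
have cardP : (#|[set x in P]| <= N * D + 3)%N by rewrite cardsE (leq_trans (card_size _)).
have [|v||A [S [[szA uA AP cA] [SA absA sumS]]]] := Habs [set x in P] _ g.
- by have [] := le #|[set x in P]| ltac:(move: cardP; clear; lia).
- exact/ltW.
- have [v _] : exists v : V, v \in V by apply/card_gt0P; rewrite (leq_trans _ V2).
  by rewrite (bigD1 v) //= ltr_pwDl // sumr_ge0 // => u _; apply: ltW.
have [s1 [x [y [z AE]]]] : exists s1 x y z, A = s1 ++ [:: x; y; z] by apply: drop3P; rewrite szA.
have exyz : e x y z.
  by apply: (@clique_path_edge _ _ s1 _ _ _ [::]); rewrite -AE ?szA.
pose F2 := [set v in P ++ A].
have [|C [szC uC CF cC]] := Hcon F2 _ _ _ _ _ _ _ exyz epqr.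
  have [] // := le #|F2| _; rewrite cardsE (leq_trans (card_size _)) // size_cat szA.
  by move: szP; clear; lia.
exists (A ++ C ++ P), (S :: Ss); split.
- by rewrite !size_cat szA mulSn {1}/D -!addnA leq_add2l leq_add.
- rewrite !cat_uniq uA uC uP /= andbT; apply/andP; split; apply/hasPn => v.
    rewrite mem_cat => /orP [/(allP CF)|vP]; first by rewrite inE mem_cat negb_or => /andP [].
    by apply/negP => /(allP AP); rewrite inE vP.
  by move=> vP; apply/negP => /(allP CF); rewrite inE mem_cat vP.
- have := cA; rewrite {1}AE => cA1; rewrite PE AE; apply: clique_path_glue => //.
  by rewrite -PE.
- by apply: (absorbing_extend PE AE) cA cC absA aP; rewrite szA.
split; last 1 first.
- rewrite exprS -mulrA; apply: le_trans (_ : (1 - c / 2) * \sum_v g v <= _); last first.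
    by apply: ler_wpM2l => //; move: c1; clear; lra.
  have -> : \sum_v (1 / 2) ^+ hits v (S :: Ss) = \sum_v g v - 1 / 2 * \sum_(v in S) g v.
    rewrite [\sum_(v in S) _]big_mkcond mulr_sumr -sumrB; apply: eq_bigr => v _.
    rewrite /g /hits /=; case: (v \in S); rewrite ?mulr0 ?subr0 //=.
    by rewrite add1n exprS; move: (_ ^+ _); clear => k; lra.
  by move: sumS; move: (\sum_v g v) (\sum_(v in S) g v); clear => a b; lra.
- have [a1 [a2 [a3 [t tE]]]] : exists a1 a2 a3 t, A = [:: a1, a2, a3 & t].
    by apply: take3P; rewrite szA.
  exists a1, a2, a3, (t ++ C ++ P); split; first by rewrite tE.
  by apply: (@clique_path_edge _ _ [::] _ _ _ t); rewrite -tE ?szA.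
by rewrite /= szS.
Qed.

(** * The theorem *)

Section Edges.
Variables (V : finType) (H : three_graph V).

Let edge3 x y z := [set x; y; z] \in edges H.

Lemma edge_tripleC x y z : edge3 x y z = edge3 y x z.
Proof. by rewrite /edge3 (setUC [set x]). Qed.

Lemma edge_tripleA x y z : edge3 x y z = edge3 x z y.
Proof. by rewrite /edge3 -!setUA (setUC [set y]). Qed.

Lemma edge_tripleI x y : edge3 x x y = false.
Proof.
apply/negP => /edges_card3; rewrite setUid => c3.
by have := cards2 x y; rewrite c3; case: (x != y).
Qed.

Definition edge_triples : triple_system V :=
  TripleSystem edge_tripleC edge_tripleA edge_tripleI.

Lemma codegree_nbr x y : x != y -> (codegree H x y <= #|nbr edge_triples x y|)%N.
Proof.
move=> xy; apply: leq_trans (leq_imset_card (fun z => [set x; y; z]) _).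
apply: subset_leq_card; apply/subsetP => E; rewrite inE => /and3P [EH xE yE].
have c3 := edges_card3 EH.
have : #|E :\ x :\ y| == 1%N.
  have yE' : y \in E :\ x by rewrite !inE eq_sym xy.
  by move: c3; rewrite (cardsD1 x) xE (cardsD1 y) yE' => /eqP.
case/cards1P=> z zE; have EE : E = [set x; y; z].
  apply/setP => v; have /setP /(_ v) := zE; rewrite !inE.
  case: (eqVneq v x) => [->|_]; first by rewrite xE.
  by case: (eqVneq v y) => [->|_] //= ->.
by apply/imsetP; exists z => //; rewrite inE /= /edge3 -EE.
Qed.

Lemma K4_is_K43 a b c d : K4 edge_triples a b c d -> is_K43 H [set x in [:: a; b; c; d]].
Proof.
move=> K; have /and4P [/tri_neq [n1 n2 n3] /tri_neq [_ n4 n5] /tri_neq [_ _ n6] _] := K.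
have {K} /and4P [] : K4 edge_triples a b c d by [].
rewrite /= /edge3 => e1 e2 e3 e4.
have c4 : #|[set x in [:: a; b; c; d]]| = 4.
  rewrite cardsE; apply/card_uniqP.
  by rewrite /= !inE !negb_or n1 n2 n3 n4 n5 n6.
apply/andP; split; first by rewrite c4.
apply/forallP => T; apply/implyP => /andP [TS /eqP c3].
have : #|[set x in [:: a; b; c; d]] :\: T| == 1%N.
  by rewrite cardsD (setIidPr TS) c4 c3.
case/cards1P=> t tE.
have TE : T = [set x in [:: a; b; c; d]] :\ t.
  by rewrite -tE setDDr setDv set0U; apply/esym/setIidPr.
have setE p q r : t != p -> t != q -> t != r ->
    [:: a; b; c; d] =i [:: t; p; q; r] -> T = [set p; q; r].
  move=> tp tq tr h; rewrite TE; apply/setP => v; rewrite in_setD1 inE h !inE -orbA.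
  case: (eqVneq v t) => [->|_] //=.
  by rewrite (negbTE tp) (negbTE tq) (negbTE tr).
have sy x y : x != y -> y != x by rewrite eq_sym.
have : t \in [set t] by rewrite inE.
rewrite -tE in_setD => /andP [_]; rewrite !inE => /or4P [] /eqP tt.
- by rewrite (setE b c d) ?tt.
- rewrite (setE a c d) ?tt //; [exact: sy n1 | move=> v].
  by rewrite !inE; case: (v == a); case: (v == b); case: (v == c); case: (v == d).
- rewrite (setE a b d) ?tt //; [exact: sy n2 | exact: sy n3 | move=> v].
  by rewrite !inE; case: (v == a); case: (v == b); case: (v == c); case: (v == d).
rewrite (setE a b c) ?tt //; [exact: sy n4 | exact: sy n5 | exact: sy n6 | move=> v].
by rewrite !inE; case: (v == a); case: (v == b); case: (v == c); case: (v == d).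
Qed.

Lemma clique_path_squared P : (3 <= size P)%N -> uniq P -> clique_path edge_triples P ->
  squared_tight_path H P.
Proof.
move=> P3 uP /win4P cP; split=> // i iP.
have : size (take 4 (drop i P)) = 4%N.
  by rewrite size_takel // size_drop leq_subRL ?(leq_trans (leq_addr 4 i)).
case E: (take 4 _) => [|a [|b [|c [|d [|? ?]]]]] // _.
apply: K4_is_K43; apply: (cP (take i P) _ _ _ _ (drop 4 (drop i P))).
by rewrite -[RHS]/(take i P ++ ([:: a; b; c; d] ++ drop 4 (drop i P))) -E !cat_take_drop.
Qed.

End Edges.

(** Used to get n < 2^h when h is about beta^2 n and n is large. *)
Lemma square_exp2 h : (h * h <= 4 * 2 ^ h)%N.
Proof.
elim: h => // h IH; have [h3|] := leqP 3 h; last by case: h {IH} => [|[|[|]]].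
by rewrite expnS; move: (2 ^ h)%N IH => k; nia.
Qed.

Theorem lemma1p6 (R : realType) :
  forall alpha : R, 0 < alpha ->
  exists beta0 : R, 0 < beta0 /\
  forall beta : R, 0 < beta -> beta <= beta0 ->
  exists n0 : nat, forall n : nat, (n0 <= n)%N ->
  forall (V : finType) (H : three_graph V), #|V| = n ->
  (7%:R / 9%:R + alpha) * n%:R <= (min_codegree H)%:R ->
  exists P : seq V,
    [/\ squared_tight_path H P,
        (size P)%:R <= 7%:R * Num.sqrt beta * n%:R &
        forall L : {set V},
          L \subset ~: path_vertices P ->
          #|L|%:R <= beta ^+ 2 * n%:R ->
          exists P' : seq V,
            [/\ squared_tight_path H P',
                path_vertices P' = path_vertices P :|: L,
                initial_triple P' = initial_triple P &
                final_triple P' = final_triple P]].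
Proof.
move=> alpha a0; have [c [gamma [c0 c1 g0 [D [n1 Hchain]]]]] := chain a0.
pose q := 1 - c / 2; have q01 : 0 < q < 1 by move: c0 c1; rewrite /q; clear; lra.
(* Only [q ^+ K <= 1 / 4] is kept. The ratio 1/4 rather than 1/2 lets 4^-h n fall below 2^-h despite
   the factor n. *)
have [K [K0 HK]] := @poly_exp_decay R 1 q (1 / 4) ltr01 q01 ltac:(by rewrite divr_gt0).
have q4 : q ^+ K <= 1 / 4.
  apply: le_trans HK; rewrite mul1r ler_peMl ?exprn_ge0 ?(ltW (andP q01).1) //.
  by rewrite -natrX ler1n expn_gt0 addn2.
pose E : R := (K * D).+1%:R; have E1 : 1 <= E by rewrite ler1n.
have E0 : 0 < E by apply: lt_le_trans E1.
(* [beta * E <= 1] bounds the path by beta n + 3 vertices; [beta * E <= gamma / 2] leaves half of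
   [gamma] for the additive 34 of [chain]. *)
exists (Num.min 1 (gamma / 2) / E); split; first by rewrite divr_gt0 // lt_min ltr01 divr_gt0.
move=> beta b0; rewrite ler_pdivlMr // le_min => /andP [bE1 bE2].
have b1 : beta <= 1 by apply: le_trans bE1; rewrite ler_peMr // ltW.
pose r := Num.sqrt beta; have r0 : 0 < r by rewrite sqrtr_gt0.
have rr : r * r = beta by rewrite -expr2 sqr_sqrtr // ltW.
have br : beta <= r.
  by rewrite -rr ler_piMl ?(ltW r0) // -sqrtr1 ler_wsqrtr.
have [n2 Hn2] := eventually_ge (34 / (gamma / 2)).
have [n3 Hn3] := eventually_ge (3 / r).
have [n4 Hn4] := eventually_ge (16 / beta ^+ 4).
exists (maxn 2 (maxn n1 (maxn n2 (maxn n3 n4)))) => n; rewrite !geq_max.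
case/and5P=> n_2 n_1 /Hn2 {}Hn2 /Hn3 {}Hn3 /Hn4 {}Hn4 V H Vn deg.
rewrite -Vn in n_2 n_1 Hn2 Hn3 Hn4 deg *; pose N : R := #|V|%:R.
have N0 : 0 < N by rewrite ltr0n (leq_trans _ n_2).
rewrite -/N ler_pdivrMr ?divr_gt0 // in Hn2.
rewrite -/N ler_pdivrMr // in Hn3; rewrite -/N ler_pdivrMr ?exprn_gt0 // in Hn4.
have degE x y : x != y -> (7 / 9 + alpha) * N <= #|nbr (edge_triples H) x y|%:R.
  move=> xy; apply: le_trans deg _; rewrite ler_nat; apply: leq_trans (codegree_nbr H xy).
  have := leqnn (min_codegree H); rewrite leq_min_codegree //.
  by move/forallP/(_ x)/forallP/(_ y)/implyP; apply.
pose x := beta ^+ 2 * N; have x0 : 0 <= x by rewrite mulr_ge0 ?exprn_ge0 // ltW.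
pose h := Num.truncn x; have /andP [hx xh] := truncn_itv x0; rewrite -/h in hx xh.
have sizeb : (K * h * D)%:R <= E * beta * (beta * N).
  have -> : E * beta * (beta * N) = E * x by rewrite /x; ring.
  rewrite mulnAC natrM; apply: ler_pM => //; rewrite /E ler_nat; exact: leqnSn.
have bN0 : 0 <= beta * N by rewrite mulr_ge0 // ltW.
have [|P [Ss [/andP [P3 szP] uP cP aP [szS sumS]]]] := Hchain V (edge_triples H) n_1 degE (K * h)%N.
  rewrite natrD -/N; apply: le_trans (lerD sizeb Hn2) _.
  have : E * beta * (beta * N) <= gamma / 2 * N.
    apply: le_trans (_ : E * beta * N <= _); last by rewrite [E * _]mulrC ler_wpM2r // ltW.
    by rewrite ler_wpM2l ?mulr_ge0 ?(ltW E0) ?(ltW b0) // ler_piMl // ltW.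
  by clear; lra.
(* A vertex served fewer than [h] times would have weight at least 2 * 2^-h, but the total is at
   most 4^-h n < 2^-h. Here n < 2^h because 16 n <= x^2 < 4 h^2 <= 16 * 2^h. *)
have hits v : (h <= count (fun S : {set V} => v \in S) Ss)%N.
  rewrite leqNgt; apply/negP => hit.
  have : (1 / 2) ^+ count (fun S : {set V} => v \in S) Ss <= (1 / 4) ^+ h * N.
    apply: le_trans (_ : q ^+ (K * h) * N <= _).
      apply: le_trans sumS; rewrite (bigD1 v) //= lerDl sumr_ge0 // => u _.
      by rewrite exprn_ge0 ?divr_ge0.
    apply: ler_wpM2r; first exact: ltW.
    by rewrite exprM lerXn2r // nnegrE ?exprn_ge0 ?divr_ge0 // ltW //; case/andP: q01.
  pose p : R := 2 ^+ h; have p0 : 0 < p by rewrite exprn_gt0.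
  have -> : (1 / 4) ^+ h = p^-1 * p^-1 :> R.
    by rewrite /p -exprVn -exprMn; congr (_ ^+ _); field.
  have : p^-1 <= 1 / 2 * (1 / 2) ^+ count (fun S : {set V} => v \in S) Ss.
    have -> : p^-1 = (1 / 2) ^+ h by rewrite /p -exprVn mul1r.
    by rewrite -exprS ler_wiXn2l ?divr_ge0 //; clear; lra.
  have hp : h%:R * h%:R <= 4 * p.
    by rewrite /p -natrX -!natrM ler_nat square_exp2.
  have h1 : 1 <= h%:R :> R by rewrite ler1n (leq_trans _ hit).
  have xx : 16 * N <= x * x.
    have -> : x * x = N * beta ^+ 4 * N by rewrite /x; ring.
    by apply: ler_wpM2r Hn4; apply: ltW.
  have Np : N < p.
    have xh2 : x * x < (2 * h%:R) * (2 * h%:R).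
      by apply: ltr_pM => //; rewrite -natr1 in xh; apply: lt_le_trans xh _; move: h1; clear; lra.
    by move: xh2 xx hp; clear; nra.
  move: (_ ^+ count _ _) => y y1 y2.
  have : p^-1 * p^-1 * N < p^-1.
    by rewrite -mulrA gtr_pMr ?invr_gt0 // mulrC ltr_pdivrMr // mul1r.
  by have : 0 < p^-1 by [rewrite invr_gt0]; move: y1 y2; clear; lra.
exists P; split; first exact: clique_path_squared.
  apply: le_trans (_ : (K * h * D + 3)%:R <= _); first by rewrite ler_nat.
  rewrite natrD -mulrA -/r -/N; apply: le_trans (lerD sizeb Hn3) _.
  have : E * beta * (beta * N) <= r * N.
    apply: le_trans (_ : beta * N <= _); first by rewrite ler_piMl // mulrC.
    by apply: ler_wpM2r br; apply: ltW.
  have : 0 < r * N by rewrite mulr_gt0.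
  by rewrite [N * r]mulrC; clear; lra.
move=> L LP Lh.
have Lh' : (#|L| <= h)%N.
  by rewrite -ltnS -(ltr_nat R); apply: le_lt_trans xh.
have [v|os [fos pos]] := @fits_exists V (enum L) Ss.
  by rewrite -cardE => _; apply: leq_trans Lh' (hits v).
have [P' [cP' pm tP dP]] := aP os fos.
have pmL : perm_eq P' (enum L ++ P) by rewrite (permPl pm) perm_cat2r.
exists P'; split=> //.
  apply: clique_path_squared => //.
    by rewrite (perm_size pmL) size_cat (leq_trans P3) ?leq_addl.
  rewrite (perm_uniq pmL) cat_uniq enum_uniq uP andbT /=; apply/hasPn => v vP.
  rewrite /= mem_enum; apply/negP => /(subsetP LP).
  by rewrite !inE vP.
by apply/setP => v; rewrite !inE (perm_mem pmL) mem_cat mem_enum orbC.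
Qed.
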